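(* Let $k\ge2$ be an integer, $d=k-1$, let $\boldsymbol\omega\in\mathcal G_{k,\ell}$ for an integer $\ell$, and let $\Lambda\subset\mathbb R^k$ be a unimodular lattice. Suppose $\phi:[1,\infty)\to[1,\infty)$ is a non-decreasing function (such that the function $L$ below is well defined) satisfying $$|H(\boldsymbol\lambda)\,\lambda_k|>\frac1{\phi(H(\boldsymbol\lambda))}$$ for every non-zero $(\boldsymbol\lambda,\lambda_k)\in\Lambda^*$ (with $\boldsymbol\lambda\in\mathbb R^d$, $\lambda_k\in\mathbb R$), as well as $$\xi:=\limsup_{x\to\infty}\frac{\phi(2x)}{\phi(x)}<\infty.$$ If $$\ell>2+2\,\frac{\log\xi}{\log2},$$ then there is a constant $C$, not depending on $N$, such that for every positive integer $N\ge\phi(1)$, $$D_{\boldsymbol\omega}(\Lambda;N)\le C\,\phi(L(N)).$$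
   Context: Notation. For $\mathbf m\in\mathbb R^d$, $H(\mathbf m)=\prod_{i\le d}\max\{1,|m_i|\}$. $e(z)=e^{2\pi i z}$ and $\widehat f(\xi)=\int_{\mathbb R}f(x)e(-\xi x)\,dx$. A lattice $\Lambda=A\mathbb Z^k$ ($A\in\mathbb R^{k\times k}$ invertible) is unimodular if $|\det A|=1$; its dual lattice is $\Lambda^*=(A^{-1})^T\mathbb Z^k$. The function $L$. For $x\ge\phi(1)$, $L(x)\in[1,x]$ denotes the value of $H$ such that $H\phi(H)=x$. (It is unique because $H\mapsto H\phi(H)$ is strictly increasing; it is assumed that it exists for every $x\ge\phi(1)$, which is the case exactly when $\phi$ is continuous.) The class $\mathcal G_{k,\ell}$. It is the set of $\boldsymbol\omega=(\omega_1,\ldots,\omega_k)$ such that for each $i\le k$: $\omega_i:\mathbb R\to[0,\infty)$ is $\ell$ times continuously differentiable, $\mathrm{supp}(\omega_i)\subseteq[-2,2]$, $\widehat\omega_i\ge0$ everywhere, and $\widehat\omega_i(0)>0$. Smooth lattice discrepancy. Put $\mathfrak C(\boldsymbol\omega)=\widehat\omega_1(0)\cdots\widehat\omega_k(0)$. A box is a pair $\mathfrak B=(\boldsymbol\gamma;\boldsymbol\rho)$ with $\boldsymbol\gamma\in\mathbb R^d$, $\boldsymbol\rho\in(0,1/2)^d$, and $\mathrm{vol}(\mathfrak B;N)=\rho_1\cdots\rho_dN$. Define $$D^\Lambda_{\boldsymbol\omega}(\mathfrak B;N)=\sum_{(\boldsymbol\lambda,\lambda_k)\in\Lambda}\omega_k\Big(\frac{\lambda_k}{N}\Big)\prod_{i\le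 d}\omega_i\Big(\frac{\lambda_i-\gamma_i}{\rho_i}\Big)-\mathfrak C(\boldsymbol\omega)\,\mathrm{vol}(\mathfrak B;N)$$ and $D_{\boldsymbol\omega}(\Lambda;N)=\sup_{\mathfrak B}|D^\Lambda_{\boldsymbol\omega}(\mathfrak B;N)|$, the supremum being over all boxes $\mathfrak B=(\boldsymbol\gamma;\boldsymbol\rho)$ with $\boldsymbol\gamma\in\mathbb R^d$ and $\boldsymbol\rho\in(0,1/2)^d$. *)

(* Defs.v *)
From HB Require Import structures.
From mathcomp Require Import all_boot all_order all_algebra.
From mathcomp Require Import all_classical all_reals all_analysis.
From mathcomp Require Import complex.

Set Implicit Arguments.
Unset Strict Implicit.
Unset Printing Implicit Defensive.

Import Order.TTheory GRing.Theory Num.Theory.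
Import numFieldNormedType.Exports.

Local Open Scope classical_set_scope.
Local Open Scope ring_scope.
Local Open Scope complex_scope.

Definition expi {R : realType} (z : R) : R[i] :=
  cos (2 * pi * z) +i* sin (2 * pi * z).

(* The library has no integral of complex-valued functions; real and imaginary
   parts are integrated separately. *)
Definition cintegral {R : realType} (g : R -> R[i]) : R[i] :=
  (\int[lebesgue_measure]_x complex.Re (g x))
    +i* (\int[lebesgue_measure]_x complex.Im (g x)).

Definition fourier {R : realType} (f : R -> R) (xi : R) : R[i] :=
  cintegral (fun x => (f x)%:C * expi (- xi * x)).

Definition continuously_differentiable {R : realType} (l : nat) (f : R -> R) :=
  (forall i x, (i < l)%N -> derivable (derive1n i f) x 1) /\ continuous (derive1n l f).

Definition supp {R : realType} (f : R -> R) : set R :=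
  closure [set x | f x != 0].

(* On [R[i]], [0 <= z] means that [z] is real and nonnegative, and [0 < z] that
   it is real and positive. *)
Definition classG {R : realType} (k l : nat) (omega : 'I_k -> R -> R) :=
  forall i : 'I_k,
    [/\ forall x, 0 <= omega i x,
        continuously_differentiable l (omega i),
        supp (omega i) `<=` `[-2, 2],
        forall xi, 0 <= fourier (omega i) xi
      & 0 < fourier (omega i) 0].

(* Vectors of R^k with k = d + 1 are split as (v_1, ..., v_d; v_k). *)
Definition initv {R : realType} (d : nat) (v : 'cV[R]_d.+1) : 'cV[R]_d :=
  \col_(i < d) v (widen_ord (leqnSn d) i) 0.

Definition lastv {R : realType} (d : nat) (v : 'cV[R]_d.+1) : R := v ord_max 0.

Definition height {R : realType} (d : nat) (m : 'cV[R]_d) : R :=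
  \prod_(i < d) Num.max 1 `|m i 0|.

(* A lattice is presented by a basis matrix [A]; [dual_lattice A] is the dual of
   [lattice A]. *)
Definition lattice {R : realType} (k : nat) (A : 'M[R]_k) : set 'cV[R]_k :=
  [set A *m map_mx intr z | z in [set: 'cV[int]_k]].

Definition dual_lattice {R : realType} (k : nat) (A : 'M[R]_k) : set 'cV[R]_k :=
  lattice (invmx A)^T.

Definition unimodular_basis {R : realType} (k : nat) (A : 'M[R]_k) :=
  A \in unitmx /\ `|\det A| = 1.

Definition frakC {R : realType} (k : nat) (omega : 'I_k -> R -> R) : R :=
  complex.Re (\prod_(i < k) fourier (omega i) 0).

Definition box_vol {R : realType} (d : nat) (rho : 'cV[R]_d) (N : nat) : R :=
  (\prod_(i < d) rho i 0) * N%:R.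

(* [esum] is the sum of a family of nonnegative terms: the weights are
   nonnegative on [classG]. *)
Definition box_discrepancy {R : realType} (d : nat)
    (omega : 'I_d.+1 -> R -> R) (Lam : set 'cV[R]_d.+1)
    (gamma rho : 'cV[R]_d) (N : nat) : \bar R :=
  (\esum_(v in Lam)
     (omega ord_max (lastv v / N%:R) *
      \prod_(i < d) omega (widen_ord (leqnSn d) i)
                      ((initv v i 0 - gamma i 0) / rho i 0))%:E
   - (frakC omega * box_vol rho N)%:E)%E.

Definition discrepancy {R : realType} (d : nat)
    (omega : 'I_d.+1 -> R -> R) (Lam : set 'cV[R]_d.+1) (N : nat) : \bar R :=
  ereal_sup [set D | exists gamma rho : 'cV[R]_d,
    (forall i, 0 < rho i 0 < 1 / 2) /\
    D = `|box_discrepancy omega Lam gamma rho N|%E].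

(* Main.v *)
Require Import Defs.
From mathcomp Require Import all_boot all_order all_algebra.
From mathcomp Require Import all_classical all_reals all_analysis.
From mathcomp Require Import complex ring lra zify.
Set Implicit Arguments.
Unset Strict Implicit.
Unset Printing Implicit Defensive.
Import Order.TTheory GRing.Theory Num.Theory.
Import numFieldNormedType.Exports.
Local Open Scope classical_set_scope.
Local Open Scope ring_scope.

(** Put k = d + 1 and H = L N, so that H * phi H = N and the claim is a bound
    O(N / H), uniform in the box. With r = (rho, N) and g = (gamma, 0) the
    weight of a lattice point v is the product of the
    f_i (v_i) = omega_i ((v_i - g_i) / r_i), and Poisson summation writes the
    discrepancy as a sum over the non-zero points m of the dual lattice of
    terms of modulus at most
      r_1 ... r_k * prod_i |fourier omega_i (r_i m_i)|
        <= C * r_1 ... r_k * prod_i (max 1 (r_i |m_i|))^-2,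
    because the omega_i are compactly supported and at least twice
    continuously differentiable: xi >= 1, so ln xi >= 0 and l > 2.

    The sum over the dual lattice is [dual_sum_bound]. Up to a constant,
    (max 1 t)^-2 is the sum of 4^-a over the a such that t <= 2^a, so the
    sum is a weighted count of the dual points in the dyadic boxes
    |m_i| <= X_i := 2^a_i / rho_i (i <= d), |m_k| <= Y := 2^b / N. Let X be
    the product of the X_i. If X >= H, such a box is covered by O(X / H)
    translates of a box with sides X'_i in [1, X_i] of product H; two dual
    points in the same translate differ by a point of height at most H, hence
    by more than 1 / (H phi H) = 1 / N in the last coordinate, so that the box
    has O((X / H) (1 + Y N)) points. If X < H, the same argument with X' = X
    applies, and the existence of one non-zero point in the box already
    forces Y X phi H >= 1. In both cases the count is
    O(X (1 / H + Y phi H)) = O(2^(a_1 + ... + a_d + b) / (rho_1 ... rho_d H))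
    ([count_box]), which the weights 4^-a sum to O(1 / (rho_1 ... rho_d H)).

    Poisson summation itself is replaced by a finite identity. Let B be
    T * A^-1 rounded to integers. The lattice T B^-1 Z^k is close to A Z^k and
    contains T Z^k. With M a suitable multiple of det B, it lies in the grid
    h Z^k of mesh h = T / M, and the sum of the f_i over it becomes a sum over
    the image of an integer matrix acting on (Z/M)^k. There, Fourier inversion
    is the orthogonality of characters ([sum_mulmx_dft]); the number of
    times each point is hit is a determinant, by the Smith normal form
    ([card_kernel_map_intr], [sum_periodized]); the frequency 0 contributes
    Riemann sums for the product of the r_i * int omega_i
    ([sampled_mass_error]); and the second differences of the samples give the
    decay of the other coefficients ([dft_sample_decay]). This proves the
    estimate for T B^-1 Z^k ([rational_lattice_bound]).

    Finally T goes to infinity with N and the box fixed. Only the dual points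
    of height at most H and with last coordinate below 1 enter the counting
    argument; there are finitely many, so that the strict Diophantine
    inequality survives the approximation ([near_diophantine]), with bounds
    that do not depend on T ([smooth_lattice_count]). *)

(** * Kernels of integer matrices modulo M *)

Lemma sum_col_prod (S : comPzSemiRingType) (F : finType) k
    (G : 'I_k -> F -> S) :
  \sum_(z : 'cV[F]_k) \prod_j G j (z j 0) = \prod_j \sum_x G j x.
Proof.
rewrite bigA_distr_bigA /=.
rewrite (reindex (fun f : {ffun 'I_k -> F} => \col_j f j)) /=.
  by apply: eq_bigr => f _; apply: eq_bigr => j _; rewrite mxE.
exists (fun z : 'cV[F]_k => [ffun j => z j 0]) => [f _|z _].
  by apply/ffunP => j; rewrite ffunE mxE.
by apply/colP => j; rewrite mxE ffunE.
Qed.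

Lemma intr_Zp_eq0 M (z : int) : (1 < M)%N ->
  (z%:~R == 0 :> 'Z_M) = (M %| z)%Z.
Proof.
move=> M1; have nE n : (n%:R == 0 :> 'Z_M) = (M %| n)%N.
  by rewrite -val_eqE /= val_Zp_nat.
case: z => n; first exact: nE.
by rewrite NegzE mulrNz oppr_eq0 [LHS]nE dvdzE abszN.
Qed.

(** The annihilator of a divisor e of M is generated by M / e: its elements
    are the multiples i * (M / e) with i < |e|. *)
Lemma card_Zp_torsion M (e : int) : (1 < M)%N -> (e %| M%:Z)%Z ->
  #|[pred x : 'Z_M | e%:~R * x == 0]| = `|e|%N.
Proof.
move=> M1; rewrite dvdzE [`|M%:Z|%N]/=; set n := `|e|%N => eM.
have M0 : (0 < M)%N by rewrite ltnW.
have n0 : (0 < n)%N by rewrite (dvdn_gt0 M0).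
have [q Mq] : exists q, M = (q * n)%N by exists (M %/ n)%N; rewrite divnK.
have q0 : (0 < q)%N by move: M0; rewrite Mq muln_gt0 => /andP[].
have testE (x : 'Z_M) : (e%:~R * x == 0) = (q %| x)%N.
  rewrite -[in LHS](natr_Zp x) -[_%:R]/((x%:Z)%:~R) -intrM intr_Zp_eq0 //.
  by rewrite dvdzE abszM -/n mulnC -[RHS](dvdn_pmul2r n0) -Mq.
have eqM : (Zp_trunc M).+2 = M by exact: Zp_cast.
(* q = M / n generates the annihilator. *)
pose f (i : 'I_n) : 'Z_M := inZp (i * q).
have fE (i : 'I_n) : f i = (i * q)%N :> nat.
  by rewrite /= eqM modn_small // [leqRHS]Mq mulnC ltn_pmul2l.
have finj : injective f.
  move=> i j /(congr1 (@nat_of_ord _)); rewrite !fE => /eqP.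
  by rewrite eqn_pmul2r // => /eqP /ord_inj.
rewrite -[RHS]card_ord -(fintype.card_image finj); apply: eq_card => x.
rewrite inE testE; apply/idP/fintype.imageP => [/dvdnP[i xE]|[i _ ->]].
  have iM : (i < n)%N.
    by rewrite -(ltn_pmul2r q0) -xE mulnC -Mq -[X in (_ < X)%N]eqM ltn_ord.
  by exists (Ordinal iM) => //; apply: ord_inj; rewrite xE fE.
by rewrite fE dvdn_mull.
Qed.

Lemma card_kernel_unit (F : finComUnitRingType) k (L D Q : 'M[F]_k) :
  L \in unitmx -> Q \in unitmx ->
  #|[pred z : 'cV[F]_k | L *m D *m Q *m z == 0]| =
  #|[pred z : 'cV[F]_k | D *m z == 0]|.
Proof.
move=> Lu Qu.
rewrite -!sum1_card [RHS](reindex_inj (can_inj (@mulKmx _ _ 1 _ Qu))) /=.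
apply: eq_bigl => z; rewrite !inE -!mulmxA.
by rewrite -[RHS](inj_eq (can_inj (mulKmx Lu))) mulmx0.
Qed.

(** By the Smith normal form U is equivalent to a diagonal matrix. Since
    U *m B is the scalar M, each diagonal entry divides M, and the kernel is a
    product of torsion subgroups whose orders multiply to the absolute value of
    the determinant. The ring F stands for Z/M, of which only the orders of
    these subgroups matter. *)
Lemma card_kernel_map_intr (F : finComUnitRingType) (M : int) k
    (U B : 'M[int]_k) :
  (forall e : int, (e %| M)%Z -> #|[pred x : F | e%:~R * x == 0]| = `|e|%N) ->
  U *m B = M%:M ->
  #|[pred z : 'cV[F]_k | map_mx intr U *m z == 0]| = `|\det U|%N.
Proof.
move=> torsion UB; have [L Lu [Q Qu [d _ UE]]] := int_Smith_normal_form U.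
set D := \matrix_(i, j) _ in UE.
have Dcol n (z : 'M[int]_(k, n)) i j : (D *m z) i j = d`_i * z i j.
  rewrite mxE (bigD1 i) //= mxE eqxx mulr1n big1 ?addr0 // => a ia.
  by rewrite mxE val_eqE eq_sym (negbTE ia) mulr0n mul0r.
have DX : D *m (Q *m B *m L) = M%:M.
  have : invmx L *m (U *m B) *m L = invmx L *m M%:M *m L by rewrite UB.
  rewrite UE !mulmxA (mulVmx Lu) mul1mx => ->.
  by rewrite -(mulmxA _ _ L) -scalar_mxC mulmxA mulVmx ?mul1mx.
have dvd (i : 'I_k) : (d`_i %| M)%Z.
  apply/dvdzP; exists ((Q *m B *m L) i i); rewrite mulrC -Dcol DX mxE eqxx.
  by rewrite mulr1n.
have unit_det (X : 'M[int]_k) : X \in unitmx -> `|\det X|%N = 1%N.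
  move=> /mulmxV /(congr1 determinant); rewrite det_mulmx det1.
  by move=> /(congr1 absz); rewrite abszM => /eqP; rewrite muln_eq1 => /andP[/eqP].
have detD : \det D = \prod_(i < k) d`_i.
  have -> : D = diag_mx (\row_i d`_i).
    apply/matrixP => i j; rewrite !mxE val_eqE; case: eqP => // <-; exact: erefl.
  by rewrite det_diag; apply: eq_bigr => i _; rewrite mxE.
have absP (g : 'I_k -> int) :
    `|(\prod_(i < k) g i)%R|%N = (\prod_(i < k) `|g i|)%N.
  by apply: (big_morph absz) => // x y; rewrite abszM.
have umod (X : 'M[int]_k) : 
    X \in unitmx -> (map_mx intr X : 'M[F]_k) \in unitmx.
  move=> Xu; have := mulVmx Xu; move/(congr1 (map_mx (intr : int -> F))).
  by rewrite map_mxM map_mx1 => /mulmx1_unit[].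
have -> : `|\det U|%N = (\prod_(i < k) `|(d`_i)%R|)%N.
  by rewrite UE !det_mulmx !abszM (unit_det L) // (unit_det Q) // mul1n muln1 detD absP.
transitivity #|[pred z : 'cV[F]_k | map_mx intr D *m z == 0]|.
  have := card_kernel_unit (map_mx intr D) (umod _ Lu) (umod _ Qu).
  have -> : map_mx intr U =
      map_mx intr L *m map_mx intr D *m map_mx intr Q :> 'M[F]_k.
    by rewrite UE !map_mxM.
  by move->.
rewrite -sum1_card.
rewrite (eq_bigl (fun z : 'cV[F]_k =>
  [forall i : 'I_k, (d`_i)%:~R * z i 0 == 0])).
  rewrite big_mkcond /=.
  rewrite (eq_bigr (fun z : 'cV[F]_k => \prod_(i < k)
     (((d`_i)%:~R * z i 0)%R == 0%R : nat))%N) => [|z _].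
    rewrite (@sum_col_prod nat _ _ (fun i x => ((d`_i)%:~R * x == 0 :> F : nat))).
    apply: eq_bigr => i _; rewrite -(torsion _ (dvd i)) -sum1_card.
    by rewrite [RHS]big_mkcond; apply: eq_bigr => x _; rewrite !inE; case: eqP.
  case: ifPn => [/forallP all0|/forallPn[i ni]].
    by rewrite big1 // => i _; rewrite all0.
  by rewrite (bigD1 i) //= (negbTE ni) mul0n.
have DzE (z : 'cV[F]_k) i : (map_mx intr D *m z) i 0 = (d`_i)%:~R * z i 0.
  rewrite mxE (bigD1 i) //= !mxE eqxx mulr1n big1 ?addr0 // => a ia.
  by rewrite !mxE val_eqE eq_sym (negbTE ia) mulr0n mul0r.
move=> z; rewrite !inE; apply/eqP/forallP => [/colP z0 i|z0].
  by rewrite -DzE z0 mxE.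
by apply/colP => i; rewrite DzE (eqP (z0 i)) mxE.
Qed.

(** * Finite Fourier analysis *)

(** The last field makes the pairing (n, x) |-> chi (n * x) non-degenerate,
    which is what Fourier inversion on F amounts to. *)
Record is_character (C : numFieldType) (F : finComUnitRingType)
    (chi : F -> C) : Prop := IsCharacter {
  char0 : chi 0 = 1;
  charD : forall x y, chi (x + y) = chi x * chi y;
  char_norm : forall x, `|chi x| = 1;
  char_sum : forall n, \sum_x chi (n * x) = #|F|%:R * (n == 0)%:R
}.

Definition dft (C : numFieldType) (F : finComUnitRingType) (chi : F -> C)
  (a : F -> C) (n : F) : C := \sum_j a j * chi (- (n * j)).

Lemma char_prod (C : numFieldType) (F : finComUnitRingType) (chi : F -> C)
    k (g : 'I_k -> F) : is_character chi ->
  \prod_i chi (g i) = chi (\sum_i g i).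
Proof.
by move=> chiP; rewrite (big_morph chi (charD chiP) (char0 chiP)).
Qed.

Lemma dft_inversion (C : numFieldType) (F : finComUnitRingType) (chi : F -> C)
    (a : F -> C) (j : F) : is_character chi ->
  \sum_n dft chi a n * chi (n * j) = #|F|%:R * a j.
Proof.
move=> chiP; rewrite /dft.
under eq_bigr => n _ do rewrite mulr_suml.
rewrite exchange_big /= (bigD1 j) //= [X in _ + X]big1 ?addr0 => [|i ij].
  under eq_bigr => n _ do rewrite -mulrA -(charD chiP) addNr (char0 chiP) mulr1.
  by rewrite sumr_const mulr_natl.
rewrite (eq_bigr (fun n => a i * chi ((j - i) * n))) => [|n _].
  by rewrite -mulr_sumr (char_sum chiP) subr_eq0 eq_sym (negbTE ij) !mulr0.
by rewrite -mulrA -(charD chiP) mulrBl addrC !(mulrC n).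
Qed.

(** Poisson summation for the submodule A *m F^k. Expanding each a i by
    Fourier inversion, the sum over z of chi (n^T *m A *m z) is #|F|^k if
    A^T *m n = 0, and 0 otherwise. *)
Lemma sum_mulmx_dft (C : numFieldType) (F : finComUnitRingType)
    (chi : F -> C) k (A : 'M[F]_k) (a : 'I_k -> F -> C) : is_character chi ->
  \sum_(z : 'cV[F]_k) \prod_i a i ((A *m z) i 0) =
  \sum_(n : 'cV[F]_k | A^T *m n == 0) \prod_i dft chi (a i) (n i 0).
Proof.
move=> chiP; set q : C := #|F|%:R.
have q0 : q != 0 by rewrite pnatr_eq0 -lt0n; apply/card_gt0P; exists 0.
apply: (mulfI (expf_neq0 k q0)); rewrite !mulr_sumr.
transitivity (\sum_(z : 'cV[F]_k) \sum_(n : 'cV[F]_k)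
    \prod_i (dft chi (a i) (n i 0) * chi (n i 0 * (A *m z) i 0))).
  apply: eq_bigr => z _.
  rewrite (sum_col_prod (fun i n => dft chi (a i) n * chi (n * (A *m z) i 0))).
  under [RHS]eq_bigr => i _ do rewrite dft_inversion //.
  by rewrite big_split /= prodr_const card_ord.
rewrite exchange_big [RHS]big_mkcond /=; apply: eq_bigr => n _.
under eq_bigr => z _ do rewrite big_split /=.
rewrite -mulr_sumr mulrC.
have -> : \sum_(z : 'cV[F]_k) \prod_i chi (n i 0 * (A *m z) i 0) =
    \prod_j \sum_x chi ((A^T *m n) j 0 * x).
  rewrite -sum_col_prod; apply: eq_bigr => z _; rewrite !char_prod //.
  congr (chi _); transitivity ((n^T *m (A *m z)) 0 0).
    by rewrite mxE; apply: eq_bigr => i _; rewrite !mxE.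
  rewrite mulmxA mxE; apply: eq_bigr => j _; congr (_ * _).
  by rewrite -[A in LHS]trmxK -trmx_mul mxE.
under eq_bigr => j _ do rewrite (char_sum chiP).
rewrite big_split /= prodr_const card_ord -mulrA; case: eqP => [An|/eqP].
  by rewrite big1 ?mul1r // => j _; rewrite An mxE eqxx.
case/cV0Pn => j nj.
by rewrite (bigD1 j) //= (negbTE nj) !mul0r mulr0.
Qed.

(** Summation by parts, twice: translating a by s multiplies its transform
    by chi (n * s), so the second difference of a is transformed into
    a multiple of the transform of a. *)
Lemma dft_second_difference (C : numFieldType) (F : finComUnitRingType)
    (chi : F -> C) (a : F -> C) (n : F) : is_character chi ->
  `|2 - chi n - chi (- n)| * `|dft chi a n|
    <= \sum_j `|a (j + 1) + a (j - 1) - 2 * a j|.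
Proof.
move=> chiP.
have shift s : chi (n * s) * dft chi a n = \sum_j a (j + s) * chi (- (n * j)).
  rewrite /dft mulr_sumr (reindex_inj (addIr s)) /=; apply: eq_bigr => j _.
  by rewrite mulrCA -(charD chiP) mulrDr opprD addrCA subrr addr0.
have -> : `|2 - chi n - chi (- n)| * `|dft chi a n| =
    `|\sum_j (a (j + 1) + a (j - 1) - 2 * a j) * chi (- (n * j))|.
  rewrite -normrM -normrN; congr (`|_|).
  under [RHS]eq_bigr => j _ do rewrite mulrBl mulrDl -mulrA.
  rewrite sumrB big_split /= -!shift -mulr_sumr -/(dft chi a n).
  by rewrite mulrN !mulr1; ring.
apply: le_trans (ler_norm_sum _ _ _) _; apply: ler_sum => j _.
by rewrite normrM (char_norm chiP) mulr1.
Qed.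

(** * Counting separated points in a box *)

(** Cut the box into cells with sides s j. A point is determined by the
    integers floor (x i j / s j), because two points in one cell are close in
    the sense of the last hypothesis, and floor (x i j / s j) takes at most
    2 * (X j / s j) + 2 values. *)
Lemma packing (R : realType) k (I : finType) (A : {pred I})
    (x : I -> 'I_k -> R) (X s : 'I_k -> R) :
  (forall j, 0 < s j) -> (forall j, 0 <= X j) ->
  {in A, forall i j, `|x i j| <= X j} ->
  {in A &, forall i i', (forall j, `|x i j - x i' j| < s j) -> i = i'} ->
  #|A|%:R <= \prod_j (2 * (X j / s j) + 2).
Proof.
move=> s0 X0' xX sep.
pose q j := Num.truncn (X j / s j).
have X0 j : 0 <= X j / s j.
  by rewrite divr_ge0 // ltW.
have qX j : (q j)%:R <= X j / s j < (q j).+1%:R by exact: truncn_itv.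
pose c i j := Num.floor (x i j / s j) + (q j).+1%:Z.
have c_range i j : i \in A -> 0 <= c i j < (2 * (q j).+1)%N%:Z.
  move=> iA; have /andP[_ qX1] := qX j.
  have : `|x i j / s j| < (q j).+1%:R.
    rewrite (le_lt_trans _ qX1) // normrM normfV (gtr0_norm (s0 j)).
    by rewrite ler_pM2r ?invr_gt0 ?xX.
  rewrite ltr_norml => /andP[lo hi]; apply/andP; split.
    rewrite /c -(opprK (q j).+1%:Z) subr_ge0 floor_ge_int.
    by rewrite intrN ltW.
  rewrite mul2n -addnn PoszD ltrD2r floor_lt_int //.
pose K := \max_j (2 * (q j).+1)%N.
have cK i j : i \in A -> (`|c i j| < 2 * (q j).+1)%N.
  by move=> /c_range => /(_ j) /andP[c0]; rewrite -[X in X < _]gez0_abs.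
have qK j : (2 * (q j).+1 <= K.+1)%N.
  by rewrite leqW // (@leq_bigmax _ (fun j => 2 * (q j).+1)%N).
pose cell i : {ffun 'I_k -> 'I_K.+1} := [ffun j => inord `|c i j|%N].
have cell_inj : {in A &, injective cell}.
  move=> i i' iA i'A /ffunP eqc; apply: sep => // j.
  have : c i j = c i' j.
    have := congr1 (@nat_of_ord _) (eqc j); rewrite !ffunE.
    rewrite !inordK ?(leq_trans (cK _ _ _) (qK _)) // => cc.
    have /andP[c0 _] := c_range _ j iA; have /andP[c0' _] := c_range _ j i'A.
    by rewrite -(gez0_abs c0) -(gez0_abs c0') cc.
  move/addIr => fl.
  rewrite -[ltRHS]mulr1 -ltr_pdivrMl // -[X in X * _]gtr0_norm ?invr_gt0 //.
  rewrite -normrM mulrC mulrBl.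
  have /andP[a1 a2] := floor_itv (x i j / s j).
  have /andP[b1 b2] := floor_itv (x i' j / s j).
  rewrite -fl in b1 b2; rewrite ltr_norml.
  by rewrite intrD in a2 b2; apply/andP; split; lra.
pose B j := [pred e : 'I_K.+1 | (e < 2 * (q j).+1)%N].
have : (#|A| <= \prod_j #|B j|)%N.
  have -> : (\prod_j #|B j|)%N = #|family B|.
    by rewrite card_family foldrE big_map big_enum.
  rewrite -(card_in_imset cell_inj) subset_leq_card //.
  apply/fintype.subsetP => _ /finset.imsetP[i iA ->]; apply/familyP => j.
  by rewrite ffunE inE inordK ?cK // (leq_trans (cK _ _ _) (qK _)).
rewrite -(ler_nat R) => /le_trans; apply; rewrite natr_prod.
apply: ler_prod => j _; rewrite ler0n /=.
have -> : #|B j| = (2 * (q j).+1)%N.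
  rewrite -[RHS](card_ord (2 * (q j).+1)%N).
  have winj : injective (widen_ord (qK j)).
    by move=> u v /(congr1 val) /= /val_inj.
  rewrite -(fintype.card_image winj).
  apply: eq_card => e; rewrite inE; apply/idP/fintype.imageP => [e1|[e' _ ->]].
    by exists (Ordinal e1) => //; apply: ord_inj.
  exact: (ltn_ord e').
have /andP[qX1 _] := qX j.
rewrite natrM -natr1; lra.
Qed.

Lemma widen_or_max d (P : 'I_d.+1 -> Prop) :
  (forall i, P (widen_ord (leqnSn d) i)) -> P ord_max -> forall j, P j.
Proof.
move=> Pw Pm j; have [jd|] := ltnP j d.
  by rewrite (_ : j = widen_ord (leqnSn d) (Ordinal jd)) //; apply: val_inj.
move=> dj; rewrite (_ : j = ord_max) //; apply: val_inj; apply/eqP.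
by rewrite eqn_leq dj /= -ltnS ltn_ord.
Qed.

(** Families over 'I_d.+1 made of d values followed by a value at ord_max,
    in the order in which initv and lastv split a vector. *)
Definition snoc (T : Type) d (f : 'I_d -> T) (y : T) (j : 'I_d.+1) : T :=
  if insub (val j) is Some i then f i else y.

Lemma snoc_widen T d (f : 'I_d -> T) y i :
  snoc f y (widen_ord (leqnSn d) i) = f i.
Proof.
rewrite /snoc; case: insubP => [u _ ui|]; last by rewrite /= ltn_ord.
by congr f; apply: val_inj.
Qed.

Lemma snoc_max T d (f : 'I_d -> T) y : snoc f y ord_max = y.
Proof. by rewrite /snoc insubF //= ltnn. Qed.

(** Greedy choice from the last side: it is cut down to G if it exceeds G, in
    which case the other sides become 1; otherwise it is kept, and
    G is divided by it. *)
Lemma shrink_box (R : realType) d (X : 'I_d -> R) (G : R) :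
  (forall j, 1 <= X j) -> 1 <= G <= \prod_j X j ->
  exists X' : 'I_d -> R, (forall j, 1 <= X' j <= X j) /\ \prod_j X' j = G.
Proof.
elim: d X G => [|d IH] X G X1 /andP[G1]; rewrite ?big_ord0 ?big_ord_recr /= => GX.
  exists (fun=> 1); split=> [[]//|].
  by rewrite big_ord0; apply/eqP; rewrite eq_le G1 GX.
set x := X ord_max in GX; have x1 : 1 <= x by exact: X1.
have x0 : 0 < x by exact: lt_le_trans x1.
have [xG|Gx] := leP x G; last first.
  exists (fun j => if j == ord_max then G else 1); split=> [j|].
    by case: eqP => [->|_]; rewrite ?G1 ?(ltW Gx) ?lexx ?X1.
  rewrite big_ord_recr /= eqxx big1 ?mul1r // => j _.
  by case: eqP => // /(congr1 val) /= jd; move: (ltn_ord j); rewrite jd ltnn.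
have [||X' [X'1 X'G]] := IH (X \o widen_ord (leqnSn d)) (G / x).
- by move=> j; exact: X1.
- by rewrite ler_pdivlMr // mul1r xG ler_pdivrMr.
exists (snoc X' x); split; last first.
  rewrite big_ord_recr /= snoc_max (eq_bigr X') => [|i _]; last exact: snoc_widen.
  by rewrite X'G divfK // gt_eqF.
by apply: widen_or_max => [i|]; rewrite ?snoc_widen ?X'1 // snoc_max x1 lexx.
Qed.

Lemma prod_ge1 (R : realDomainType) (I : finType) (P : pred I) (F : I -> R) :
  (forall i, 1 <= F i) -> 1 <= \prod_(i | P i) F i.
Proof.
by move=> F1; elim/big_ind: _ => // x y x1 y1; exact: mulr_ege1.
Qed.

Lemma height_le (R : realType) d (v : 'cV[R]_d) (X : 'I_d -> R) :
  (forall j, 1 <= X j) -> (forall j, `|v j 0| <= X j) ->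
  height v <= \prod_j X j.
Proof.
move=> X1 vX; apply: ler_prod => j _; rewrite le_max ler01 /=.
by rewrite ge_max X1 vX.
Qed.

Lemma height_ge0 (R : realType) d (v : 'cV[R]_d) : 0 <= height v.
Proof. by apply: prodr_ge0 => j _; rewrite le_max ler01. Qed.

(** Cover the first d coordinates by cells with sides at least 1 and volume
    G = min H (prod_j X j). Differences inside a cell have height at most
    G <= H, so that points of one cell are 1 / (G F) apart in the last
    coordinate, and [packing] gives O((prod_j X j / G) (Y G F + 1)) points. *)
Lemma count_box (R : realType) d (I : finType) (lam : I -> 'cV[R]_d.+1)
    (H F : R) (X : 'I_d -> R) (Y : R) :
  1 <= H -> 0 < F ->
  (forall i, height (initv (lam i)) <= H ->
     1 / F <= height (initv (lam i)) * `|lastv (lam i)|) ->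
  (forall i i', i != i' -> height (initv (lam i - lam i')) <= H ->
     1 / F <= height (initv (lam i - lam i')) * `|lastv (lam i - lam i')|) ->
  (forall j, 1 <= X j) -> 0 < Y ->
  #|[pred i | [forall j, `|initv (lam i) j 0| <= X j]
                && (`|lastv (lam i)| <= Y)]|%:R
    <= 4 ^+ d.+1 * (\prod_j X j) * (H^-1 + Y * F).
Proof.
move=> H1 F0 nz sep X1 Y0; set A := [pred i | _].
have H0 : 0 < H by exact: lt_le_trans H1.
have XP1 : 1 <= \prod_j X j by exact: prod_ge1.
set XP := \prod_j X j in XP1 *.
pose G := Num.min H XP.
have G1 : 1 <= G by rewrite le_min H1 XP1.
have GH : G <= H by rewrite ge_min lexx.
have GX : G <= XP by rewrite ge_min lexx orbT.
have [A0|/card_gt0P[i0 i0A]] := posnP #|A|.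
  rewrite A0 mulr_ge0 ?mulr_ge0 ?exprn_ge0 ?(le_trans ler01 XP1) //.
  by rewrite addr_ge0 ?invr_ge0 ?mulr_ge0 ?(ltW H0) ?(ltW Y0) ?(ltW F0).
have G0 : 0 < G by exact: lt_le_trans G1.
have [|X' [X'X X'G]] := @shrink_box R d X G X1; first by rewrite G1.
have X'1 j : 1 <= X' j by have /andP[] := X'X j.
have X'0 j : 0 < X' j by exact: lt_le_trans (X'1 j).
(* The height of a cell in the last direction is the separation 1 / (G F). *)
have GF0 : 0 < (G * F)^-1 by rewrite invr_gt0 mulr_gt0.
have := @packing R d.+1 I A (fun i j => lam i j 0) (snoc X Y)
  (snoc X' (G * F)^-1).
rewrite big_ord_recr /= !snoc_max invrK.
under eq_bigr => j _ do rewrite !snoc_widen.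
move=> pack; have {pack} : #|A|%:R <= \prod_j (2 * (X j / X' j) + 2)
    * (2 * (Y * (G * F)) + 2).
  apply: pack.
  - by apply: widen_or_max => [j|]; rewrite ?snoc_widen ?snoc_max.
  - by apply: widen_or_max => [j|]; rewrite ?snoc_widen ?snoc_max ?(ltW Y0)//
      (le_trans ler01).
  - move=> i; rewrite inE => /andP[/forallP iX iY].
    apply: widen_or_max => [j|]; rewrite ?snoc_widen ?snoc_max //.
    by have := iX j; rewrite mxE.
  - move=> i i' iA i'A close; apply/eqP/negP => /negP neq.
    have ht : height (initv (lam i - lam i')) <= G.
      rewrite -X'G; apply: height_le => // j.
      by have := close (widen_ord (leqnSn d) j); rewrite snoc_widen !mxE => /ltW.
    have := sep _ _ neq (le_trans ht GH); apply/negP; rewrite -ltNge.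
    have := close ord_max; rewrite snoc_max => cl.
    apply: (@le_lt_trans _ _ (G * `|lam i ord_max 0 - lam i' ord_max 0|)).
      by rewrite /lastv !mxE ler_wpM2r.
    rewrite invfM in cl; rewrite -ltr_pdivlMl // mul1r.
    exact: cl.
move=> /le_trans; apply.
have -> : 4 ^+ d.+1 * XP * (H^-1 + Y * F) =
    (4 ^+ d * (XP / G)) * (4 * G * (H^-1 + Y * F)).
  by rewrite exprS; field; rewrite !gt_eqF.
apply: ler_pM.
- by apply: prodr_ge0 => j _; rewrite addr_ge0 ?mulr_ge0 ?invr_ge0 ?(ltW (X'0 j))
    ?(le_trans ler01 (X1 j)).
- by rewrite addr_ge0 // mulr_ge0 // !mulr_ge0 ?(ltW Y0) ?(ltW G0) ?(ltW F0).
- rewrite -X'G -[d in 4 ^+ d]card_ord -prodr_const -prodfV -!big_split /=.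
  apply: ler_prod => j _; have /andP[_ X'Xj] := X'X j.
  have : 1 <= X j / X' j by rewrite ler_pdivlMr // mul1r.
  by move=> t1; apply/andP; split; lra.
have YGF0 : 0 < Y * (G * F) by rewrite !mulr_gt0.
have -> : 4 * G * (H^-1 + Y * F) = 4 * (G / H) + 4 * (Y * (G * F)) by ring.
have [HX|XH] := leP H XP.
  have -> : G = H by rewrite /G; apply/min_idPl.
  by rewrite divff ?gt_eqF //; move: YGF0; rewrite /G (min_idPl HX); lra.
have GXP : G = XP by rewrite /G; apply/min_idPr/ltW.
(* Here the box is smaller than H, so that 1 / G exceeds 1 / H. One non-zero
   point in the box makes Y G F at least 1, which absorbs the difference. *)
suff : 1 <= Y * (G * F) by have := divr_gt0 G0 H0; lra.
move: i0A; rewrite inE => /andP[/forallP i0X i0Y].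
have ht : height (initv (lam i0)) <= G by rewrite GXP; exact: height_le.
rewrite mulrA -ler_pdivrMr // (le_trans (nz _ (le_trans ht GH))) //.
by rewrite mulrC ler_pM ?height_ge0.
Qed.

(** * Summation over dyadic layers *)

(** The decay (max 1 t)^-2 is, up to the factor 4, a superposition of
    indicators of dyadic intervals: the term of the least a with t <= 2^a
    alone dominates it. *)
Lemma dyadic_layers (R : realFieldType) (t : R) K : t <= 2 ^+ K ->
  (Num.max 1 t) ^- 2 <= \sum_(a < K.+1) 4 * 4 ^- a * (t <= 2 ^+ a)%R%:R.
Proof.
move=> tK; have exa : exists a, t <= 2 ^+ a by exists K.
have terms_ge0 (a : nat) : 0 <= 4 * 4 ^- a * (t <= 2 ^+ a)%R%:R :> R.
  by rewrite !mulr_ge0 // invr_ge0 exprn_ge0.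
case: (ex_minnP exa) => a ta amin.
have aK : (a < K.+1)%N by rewrite ltnS amin.
rewrite (bigD1 (Ordinal aK)) //= ta mulr1.
rewrite (le_trans (y := 4 * 4 ^- a)) ?lerDl ?sumr_ge0 //.
have m1 : 1 <= Num.max 1 t by rewrite le_max lexx.
case: a ta amin {aK} => [_ _|a _ amin].
  rewrite expr0 invr1 mulr1 (le_trans (y := 1)) ?ler1n //.
  by rewrite invf_le1 ?exprn_ege1 // exprn_gt0 // (lt_le_trans ltr01).
have at' : 2 ^+ a < t by rewrite ltNge; apply/negP => /amin; rewrite ltnn.
have tm : t <= Num.max 1 t by rewrite le_max lexx orbT.
have -> : 4 * 4 ^- a.+1 = (2 ^+ a) ^- 2 :> R.
  rewrite exprS invfM mulrA divff // mul1r -exprM mulnC exprM.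
  by congr (_ ^+ _)^-1; rewrite -natrX.
have a0 : 0 < 2 ^+ a :> R by rewrite exprn_gt0.
rewrite lef_pV2 ?posrE ?exprn_gt0 ?(lt_le_trans ltr01 m1) //.
by rewrite lerXn2r ?nnegrE ?(ltW a0) ?(le_trans ler01 m1) //
  (le_trans (ltW at') tm).
Qed.

(** Expanding every factor in layers turns the sum into counts of points in
    dyadic boxes; the weights 4^-a win over the volumes 2^a of the boxes, with a
    factor 4 * 2 for each coordinate. *)
Lemma sum_by_layers (R : archiRealFieldType) k (I : finType)
    (t : I -> 'I_k -> R) (D : R) :
  (forall a : 'I_k -> nat,
     #|[pred i | [forall j, t i j <= 2 ^+ a j]]|%:R <= D * \prod_j 2 ^+ a j) ->
  \sum_i \prod_j (Num.max 1 (t i j)) ^- 2 <= D * 8 ^+ k.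
Proof.
move=> count; have D0 : 0 <= D.
  have := le_trans _ (count (fun=> 0%N)); rewrite big1 ?mulr1 //; apply.
  exact: ler0n.
have [K tK] : exists K, forall i j, t i j <= 2 ^+ K.
  exists (\max_(p : I * 'I_k) (Num.truncn (t p.1 p.2)).+1) => i j.
  set K := \max_(_ | _) _; have jK : ((Num.truncn (t i j)).+1 <= K)%N.
    exact: (@leq_bigmax _ (fun p => (Num.truncn (t p.1 p.2)).+1) (i, j)).
  apply/ltW/(lt_le_trans (truncnS_gt (t i j))).
  by rewrite -natrX ler_nat (leq_trans jK) // ltnW // ltn_expl.
pose w (a : 'I_K.+1) : R := 4 * 4 ^- a.
have w0 a : 0 <= w a by rewrite mulr_ge0 // invr_ge0 exprn_ge0.
apply: (@le_trans _ _ (\sum_i \sum_(f : {ffun 'I_k -> 'I_K.+1})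
    \prod_j (w (f j) * (t i j <= 2 ^+ f j)%R%:R))).
  apply: ler_sum => i _.
  rewrite -(bigA_distr_bigA (fun j a => w a * (t i j <= 2 ^+ a)%R%:R)) /=.
  apply: ler_prod => j _.
  by rewrite invr_ge0 exprn_ge0 ?le_max ?ler01 //= dyadic_layers.
rewrite exchange_big /=.
apply: (@le_trans _ _ (\sum_(f : {ffun 'I_k -> 'I_K.+1})
    D * \prod_j (w (f j) * 2 ^+ f j))).
  apply: ler_sum => f _.
  have -> : \sum_i \prod_j (w (f j) * (t i j <= 2 ^+ f j)%R%:R) =
      \prod_j w (f j) * \sum_i \prod_j (t i j <= 2 ^+ f j)%R%:R.
    by rewrite mulr_sumr; apply: eq_bigr => i _; rewrite big_split.
  rewrite [in leRHS]big_split /= mulrCA ler_wpM2l ?prodr_ge0 //.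
  apply: le_trans (count (fun j => f j)); rewrite -sum1_card natr_sum.
  rewrite [leRHS]big_mkcond /=; apply: ler_sum => i _; rewrite inE.
  case: ifPn => [/forallP ti|/forallPn[j /negbTE tj]].
    by rewrite big1 // => j _; rewrite ti.
  by rewrite (bigD1 j) //= tj mul0r.
rewrite -mulr_sumr ler_wpM2l // -(bigA_distr_bigA (fun=> fun a => w a * 2 ^+ a)).
rewrite /= prodr_const card_ord lerXn2r ?nnegrE ?sumr_ge0 // => [a _|].
  by rewrite mulr_ge0 // exprn_ge0.
have geom n : \sum_(a < n) 4 * 4 ^- a * 2 ^+ a = 4 * (2 - 2 * 2 ^- n) :> R.
  elim: n => [|n IH]; first by rewrite big_ord0; field.
  rewrite big_ord_recr /= {}IH (_ : 4 ^+ n = 2 ^+ n * 2 ^+ n).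
    by rewrite [2 ^+ n.+1]exprS; field; rewrite expf_neq0.
  by rewrite -exprMn -natrM.
rewrite [leLHS]geom.
have : 0 <= 2 ^- K.+1 :> R by rewrite invr_ge0 exprn_ge0.
lra.
Qed.

(** In the layer a the box of [count_box] has sides X j = 2 ^ a j / r j and
    Y = 2 ^ b / r ord_max. Since H * F = r ord_max, the two terms of the count
    are H^-1 and 2 ^ b * H^-1, so the count is at most \prod_j 2 ^ a j times a
    quantity that does not depend on a. *)
Lemma dual_sum_bound (R : realType) d (I : finType) (lam : I -> 'cV[R]_d.+1)
    (H F : R) (r : 'I_d.+1 -> R) :
  1 <= H -> 0 < F -> H * F = r ord_max ->
  (forall i, height (initv (lam i)) <= H ->
     1 / F <= height (initv (lam i)) * `|lastv (lam i)|) ->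
  (forall i i', i != i' -> height (initv (lam i - lam i')) <= H ->
     1 / F <= height (initv (lam i - lam i')) * `|lastv (lam i - lam i')|) ->
  (forall j, 0 < r (widen_ord (leqnSn d) j) <= 1) ->
  \sum_i \prod_j (Num.max 1 (r j * `|lam i j 0|)) ^- 2 * \prod_j r j
    <= 2 * 32 ^+ d.+1 * F.
Proof.
move=> H1 F0 HF nz sep r01; have H0 : 0 < H by exact: lt_le_trans H1.
pose rho j := r (widen_ord (leqnSn d) j).
have rho0 j : 0 < rho j by have /andP[] := r01 j.
have rho1 j : rho j <= 1 by have /andP[] := r01 j.
have N0 : 0 < r ord_max by rewrite -HF mulr_gt0.
set P := \prod_j rho j; have P0 : 0 < P by apply: prodr_gt0.
have -> : \prod_j r j = P * (H * F) by rewrite big_ord_recr HF.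
rewrite -mulr_suml -ler_pdivlMr ?mulr_gt0 //.
apply: le_trans (@sum_by_layers R d.+1 I _ (2 * 4 ^+ d.+1 / (P * H)) _) _.
  move=> a; pose a' j := a (widen_ord (leqnSn d) j); pose b := a ord_max.
  have := @count_box R d I lam H F (fun j => 2 ^+ a' j / rho j)
    (2 ^+ b / r ord_max) H1 F0 nz sep.
  set c1 := #|_|%:R; set c2 := #|_|%:R.
  have <- : c1 = c2.
    congr (_%:R); apply: eq_card => i; rewrite !inE.
    apply/idP/idP => [/andP[/forallP iX iY]|/forallP it].
      apply/forallP; apply: widen_or_max => [j|].
        by have := iX j; rewrite mxE ler_pdivlMr // mulrC.
      by move: iY; rewrite ler_pdivlMr // mulrC.
    apply/andP; split; last by rewrite ler_pdivlMr // mulrC; exact: it.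
    by apply/forallP => j; rewrite mxE ler_pdivlMr // mulrC; exact: it.
  move=> count; apply: (le_trans (count _ _)) => [j||].
    by rewrite ler_pdivlMr // mul1r (le_trans (rho1 j)) // exprn_ege1 // ler1n.
    by rewrite divr_gt0 // exprn_gt0.
  rewrite big_split /= prodfV -/P big_ord_recr /=.
  rewrite -/b -HF; set A := \prod_(_ < _) 2 ^+ _.
  have A0 : 0 <= A by apply: prodr_ge0 => j _; rewrite exprn_ge0.
  have -> : H^-1 + 2 ^+ b / (H * F) * F = (1 + 2 ^+ b) / H.
    by field; rewrite !gt_eqF.
  have -> : 4 ^+ d.+1 * (A / P) * ((1 + 2 ^+ b) / H) =
    4 ^+ d.+1 * A / (P * H) * (1 + 2 ^+ b) by field; rewrite !gt_eqF.
  have -> : 2 * 4 ^+ d.+1 / (P * H) * (A * 2 ^+ b) =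
    4 ^+ d.+1 * A / (P * H) * (2 ^+ b + 2 ^+ b) by field; rewrite !gt_eqF.
  rewrite ler_wpM2l ?divr_ge0 ?mulr_ge0 ?exprn_ge0 ?(ltW P0) ?(ltW H0) //.
  by rewrite lerD2r exprn_ege1 // ler1n.
rewrite le_eqVlt; apply/orP; left; apply/eqP.
have -> : 32 ^+ d.+1 = 4 ^+ d.+1 * 8 ^+ d.+1 :> R.
  by rewrite -exprMn -natrM.
by field; rewrite !gt_eqF.
Qed.

(** * The characters of Z/M *)

(** On [0, pi / 4] the cosine is at least 1 / 2 and the mean value theorem
    applies; beyond pi / 4 the sine is at least 1 / 2, while y < 2. *)
Lemma sin_lower_bound (R : realType) (y : R) :
  0 <= y <= pi / 2 -> y / 4 <= sin y.
Proof.
have p2 := @pi_ge2 R; have p4 := @pihalf_lt2 R.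
move=> /andP[y0 yp]; have q0 : 0 < (pi / 4 : R) by lra.
have cq : 1 / 2 <= cos (pi / 4 : R) ^+ 2.
  have := @cos_pihalf R; rewrite [pi / 2](_ : _ = pi / 4 + pi / 4); last by field.
  by rewrite cosD => /eqP; rewrite subr_eq0 => /eqP; have := cos2Dsin2 (pi / 4 : R);
    nra.
have c0 : 0 <= cos (pi / 4 : R) by apply: cos_ge0_pihalf; apply/andP; split; lra.
have c1 : 1 / 2 <= cos (pi / 4 : R).
  rewrite leNgt; apply/negP => lt; nra.
have bound (t : R) : 0 <= t <= pi / 4 -> t / 4 <= sin t.
  move=> /andP[t0 tp].
  have [|c] := @MVT_segment R (@sin R) (@cos R) 0 t t0.
    by apply: continuous_subspaceT => x; exact: continuous_sin.
  rewrite in_itv /= => /andP[c0' ct]; rewrite sin0 !subr0 => ->.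
  suff : 1 / 4 <= cos c by nra.
  apply: (@le_trans _ _ (cos (pi / 4))); first lra.
  rewrite leNgt ltr_cos ?in_itv /= -?leNgt; lra.
have [yq|qy] := leP y (pi / 4); first by apply: bound; rewrite y0.
have : sin (pi / 4) < sin y by rewrite ltr_sin ?in_itv /= ?qy //; lra.
have sq : 1 / 2 <= sin (pi / 4 : R).
  rewrite (_ : sin (pi / 4) = cos (pi / 4)) // -cosBpihalf -cosN; congr cos.
  by field.
lra.
Qed.

Lemma chord_lower_bound (R : realType) (t : R) :
  2 * `|t| <= 1 -> t ^+ 2 <= 2 - 2 * cos (2 * pi * t).
Proof.
move=> t1; have p2 := @pi_ge2 R.
have -> : 2 - 2 * cos (2 * pi * t) = 4 * sin (pi * `|t|) ^+ 2.
  have -> : cos (2 * pi * t) = cos (2 * (pi * `|t|)).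
    rewrite (_ : 2 * (pi * `|t|) = 2 * pi * `|t|) ?mulrA //.
    by case: (ger0P t) => // _; rewrite mulrN cosN.
  by rewrite [2 * (_ * _)]mulr_natl cos_mulr2n; have := cos2Dsin2 (pi * `|t|); lra.
have := @sin_lower_bound R (pi * `|t|).
have t0 := normr_ge0 t; rewrite -real_normK ?num_real //.
move=> /(_ _) sb; have {sb} : pi * `|t| / 4 <= sin (pi * `|t|).
  by apply: sb; apply/andP; split; nra.
set s := sin _ => sb; set u := `|t| in t1 t0 sb *.
have : u / 2 <= s by nra.
nra.
Qed.

Lemma expiD (R : realType) (x y : R) : expi (x + y) = expi x * expi y.
Proof. by rewrite /expi mulrDr cosD sinD; simpc; congr (_ +i* _)%C; ring. Qed.

Lemma expi0 (R : realType) : expi (0 : R) = 1.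
Proof. by rewrite /expi mulr0 cos0 sin0. Qed.

Lemma expi_int (R : realType) (n : int) : expi (n%:~R : R) = 1.
Proof.
have exp1 : expi (1 : R) = 1.
  by rewrite /expi mulr1 mulr_natl cos2pi sin2pi.
have expn (m : nat) : expi (m%:R : R) = 1.
  elim: m => [|m IH]; first exact: expi0.
  by rewrite -natr1 expiD IH exp1 mulr1.
case: n => m; first exact: expn.
have := expiD (m.+1%:R : R) (- m.+1%:R); rewrite subrr expi0 expn mul1r => ->.
by rewrite NegzE mulrNz.
Qed.

Lemma norm_expi (R : realType) (x : R) : `|expi x| = 1.
Proof. by rewrite normc_def /= cos2Dsin2 sqrtr1. Qed.

Lemma expi_conj_sum (R : realType) (x : R) :
  2 - expi x - expi (- x) = ((2 - 2 * cos (2 * pi * x))%:C)%C.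
Proof.
rewrite /expi mulrN cosN sinN -[2 : R[i]]/(1 + 1 : R[i]); simpc.
by congr (_ +i* _)%C; ring.
Qed.

(** The ring Z/M with the representatives nearest to 0. Both the sample
    points and the frequencies are read through rep: samples of a function
    with small support then do not wrap around, and 1 - chi n is of
    size |rep n| / M by [chord_lower_bound], which holds only for
    representatives of absolute value at most M / 2. *)
Record centered_residues (F : finComUnitRingType) (M : nat) (rep : F -> int) :=
  CenteredResidues {
    repK : forall x, (rep x)%:~R = x;
    rep_range : forall x, - (M./2)%:Z <= rep x < M%:Z - (M./2)%:Z;
    intr_eq0_dvd : forall z : int, (z%:~R == 0 :> F) = (M %| z)%Z;
    card_residues : #|F| = M;
    card_torsion : forall e : int, (e %| M%:Z)%Z ->
      #|[pred x : F | e%:~R * x == 0]| = `|e|%N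
  }.

Definition Zp_rep M (x : 'Z_M) : int :=
  (val (x + (M./2)%:R : 'Z_M))%:Z - (M./2)%:Z.

Lemma Zp_centered_residues M : (1 < M)%N -> centered_residues M (@Zp_rep M).
Proof.
move=> M1; have eqM : (Zp_trunc M).+2 = M by exact: Zp_cast.
split=> [x|x|z||e].
- by rewrite /Zp_rep intrB -[X in X - _]/((val _)%:R) natr_Zp addrK.
- rewrite /Zp_rep lerBrDr addNr ltrD2r le0z_nat ltz_nat.
  by rewrite -[X in (_ < X)%N]eqM ltn_ord.
- exact: intr_Zp_eq0.
- by rewrite card_ord.
- exact: card_Zp_torsion.
Qed.

Section CenteredResidues.
Variables (F : finComUnitRingType) (M : nat) (rep : F -> int).
Hypothesis repP : centered_residues M rep.

Lemma rep_intr (z : int) :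
  - (M./2)%:Z <= z < M%:Z - (M./2)%:Z -> rep z%:~R = z.
Proof.
move=> /andP[z1 z2]; have /andP[r1 r2] := rep_range repP z%:~R.
have : (M %| rep z%:~R - z)%Z.
  by rewrite -(intr_eq0_dvd repP) intrB (repK repP) subrr.
case/dvdzP => q qE; suff q0 : q = 0 by lia.
have : `|q * M| < M%:Z by rewrite -qE; lia.
case: (intP q) => // n; nia.
Qed.

Lemma rep_intr_lt (z : int) : 2 * `|z| < M%:Z -> rep z%:~R = z.
Proof. by move=> zM; apply: rep_intr; lia. Qed.

Lemma rep_le (x : F) : 2 * `|rep x| <= M%:Z.
Proof. by have := rep_range repP x; lia. Qed.

Lemma rep_inj : injective rep.
Proof. exact: can_inj (repK repP). Qed.

Lemma rep0 : (0 < M)%N -> rep 0 = 0.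
Proof. by move=> M0; have := @rep_intr_lt 0; rewrite mulr0z; apply; lia. Qed.

Lemma rep_eq0 (x : F) : (rep x == 0) = (x == 0).
Proof.
have M0 : (0 < M)%N by rewrite -(card_residues repP); apply/card_gt0P; exists 0.
by rewrite -(inj_eq rep_inj) rep0.
Qed.

Lemma sum_rep (V : nmodType) (g : int -> V) :
  \sum_x g (rep x) = \sum_(i < M) g (i%:Z - (M./2)%:Z).
Proof.
have range (i : 'I_M) : - (M./2)%:Z <= i%:Z - (M./2)%:Z < M%:Z - (M./2)%:Z.
  by have := ltn_ord i; lia.
rewrite (reindex (fun i : 'I_M => (i%:Z - (M./2)%:Z)%:~R)) /=.
  by apply: eq_bigr => i _; rewrite rep_intr.
have hr x : (absz (rep x + (M./2)%:Z)%R < M)%N.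
  by have := rep_range repP x; lia.
exists (fun x => Ordinal (hr x)) => [i _|x _].
  by apply: val_inj; rewrite /= rep_intr //; lia.
rewrite /= -[RHS](repK repP); congr (_%:~R).
by have := rep_range repP x; lia.
Qed.

Definition residue_char (R : realType) (x : F) : R[i] :=
  expi ((rep x)%:~R / M%:R).

Lemma residue_char_intr (R : realType) (z : int) :
  residue_char R z%:~R = expi (z%:~R / M%:R).
Proof.
have : (M %| rep z%:~R - z)%Z.
  by rewrite -(intr_eq0_dvd repP) intrB (repK repP) subrr.
have M0 : (0 < M)%N by rewrite -(card_residues repP); apply/card_gt0P; exists 0.
case/dvdzP => q /eqP; rewrite subr_eq => /eqP qE.
rewrite /residue_char qE intrD mulrDl expiD intrM.
by rewrite -[M%:~R]/(M%:R) mulfK ?pnatr_eq0 -?lt0n // expi_int mul1r.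
Qed.

Lemma residue_char_chord (R : realType) (x : F) :
  ((((rep x)%:~R / M%:R) ^+ 2 : R)%:C)%C
    <= `|2 - residue_char R x - residue_char R (- x)|.
Proof.
have M0 : (0 < M)%N by rewrite -(card_residues repP); apply/card_gt0P; exists 0.
rewrite -[x in residue_char R (- x)](repK repP) -intrN residue_char_intr.
rewrite intrN mulNr expi_conj_sum normc_def /= expr0n addr0 sqrtr_sqr lecR.
apply: le_trans (ler_norm _); apply: chord_lower_bound.
rewrite normrM normfV normr_nat mulrA ler_pdivrMr ?ltr0n // mul1r.
by rewrite -intr_norm -[2]/(2%:~R) -intrM -[M%:R]/(M%:~R) ler_int rep_le.
Qed.

(** For the orthogonality, translating the summation variable by 1
    multiplies the sum by chi n, and chi n differs from 1 if n is not 0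
    because of [residue_char_chord]. *)
Lemma residue_char_character (R : realType) : is_character (residue_char R).
Proof.
have M0 : (0 < M)%N by rewrite -(card_residues repP); apply/card_gt0P; exists 0.
have c0 : residue_char R 0 = 1 by rewrite /residue_char rep0 // mul0r expi0.
have cD x y : residue_char R (x + y) = residue_char R x * residue_char R y.
  rewrite -(repK repP x) -(repK repP y) -intrD !residue_char_intr.
  by rewrite intrD mulrDl expiD.
split=> // [x|n]; first exact: norm_expi.
have [->|n0] := eqVneq n 0.
  under eq_bigr => x _ do rewrite mul0r c0.
  by rewrite sumr_const mulr1.
rewrite mulr0; apply/eqP.
have : (residue_char R n - 1) * (\sum_x residue_char R (n * x)) = 0.
  rewrite mulrBl mul1r mulr_sumr [X in _ - X](reindex_inj (addIr 1)) /=.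
  apply/eqP; rewrite subr_eq0; apply/eqP; apply: eq_bigr => x _.
  by rewrite mulrDr mulr1 cD mulrC.
move/eqP; rewrite mulf_eq0 => /orP[|//]; rewrite subr_eq0 => /eqP n1.
have := residue_char_chord R n; have := cD n (- n).
rewrite subrr c0 n1 mul1r => <-; rewrite (_ : 2 - 1 - 1 = 0 :> R[i]); last ring.
rewrite normr0 lecR => le0; have : ((rep n)%:~R / M%:R) ^+ 2 == 0 :> R.
  by rewrite eq_le le0 sqr_ge0.
rewrite sqrf_eq0 mulf_eq0 invr_eq0 pnatr_eq0 (gtn_eqF M0) orbF.
by rewrite intr_eq0 rep_eq0 (negbTE n0).
Qed.

End CenteredResidues.

(** * Fourier coefficients of sampled bumps *)

Definition sample (R : realType) (F : finType) (rep : F -> int) (f : R -> R)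
  (h : R) (x : F) : R[i] := ((f (h * (rep x)%:~R))%:C)%C.

Lemma normc_real (R : realType) (x : R) : `|(x%:C)%C| = (`|x|%:C)%C.
Proof. by rewrite normc_def /= expr0n addr0 sqrtr_sqr. Qed.

Section SampledSums.
Variables (R : realType) (F : finComUnitRingType) (M : nat) (rep : F -> int).
Hypothesis repP : centered_residues M rep.

Lemma card_close_residues (h c X : R) : 0 < h -> 0 <= X ->
  #|[pred x : F | `|h * (rep x)%:~R - c| <= X]|%:R <= 2 * (X / h) + 2.
Proof.
move=> h0 X0; set A := [pred x | _].
have := @packing R 1 F A (fun x _ => h * (rep x)%:~R - c) (fun=> X) (fun=> h).
rewrite big_ord1; apply=> // x y _ _ /(_ ord0).
rewrite (_ : _ - _ = h * (rep x - rep y)%:~R); last by rewrite intrB; ring.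
rewrite normrM gtr0_norm // -ltr_pdivlMl // mulVf ?gt_eqF //.
rewrite -intr_norm -[1]/(1%:~R) ltr_int => xy; apply: (rep_inj repP); lia.
Qed.

(** Only the O(r / h) residues near g carry a non-zero sample or a non-zero
    second difference. The samples are at most K, and their second differences
    at most K (h / r)^2. The former gives the bound K r / h; the latter,
    divided by the factor (rep n / M)^2 of [dft_second_difference], gives the
    decay. The width condition keeps the support away from the residues where
    rep jumps, so that neighbours in F are neighbours on the line. *)
Lemma dft_sample_decay (w : R -> R) (K g r h : R) (n : F) :
  0 <= K -> (forall x, `|w x| <= K) -> (forall x, 2 < `|x| -> w x = 0) ->
  (forall x u, 0 < u <= 1 -> `|w (x + u) + w (x - u) - 2 * w x| <= K * u ^+ 2) ->
  0 < h <= r -> 2 * (`|g| + 2 * r + 2 * h) < h * M%:R ->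
  `|dft (residue_char M rep R) (sample rep (fun x => w ((x - g) / r)) h) n|
    <= ((8 * K * (r / h)
        * (Num.max 1 (r * `|(rep n)%:~R / (h * M%:R)|)) ^- 2)%:C)%C.
Proof.
move=> K0 wK w0 wdiff /andP[h0 hr] wide; set a := sample _ _ _.
have r0 : 0 < r by exact: lt_le_trans hr.
pose A := [pred x : F | `|h * (rep x)%:~R - g| <= 2 * r + h].
have cardA : #|A|%:R <= 8 * (r / h).
  apply: le_trans (card_close_residues g h0 _) _; first lra.
  have : 1 <= r / h by rewrite ler_pdivlMr // mul1r.
  have -> : (2 * r + h) / h = 2 * (r / h) + 1 by field; rewrite gt_eqF.
  lra.
have out (z : int) : 2 * r < `|h * z%:~R - g| -> w ((h * z%:~R - g) / r) = 0.
  move=> far; apply: w0; rewrite normrM normfV (gtr0_norm r0).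
  by rewrite ltr_pdivlMr.
have inner (z : int) : `|h * z%:~R - g| <= 2 * r + h -> 2 * (`|z| + 1) < M%:Z.
  move=> zA; rewrite -(ltr_int R) intrM [X in _ * X < _]intrD intr_norm.
  rewrite -(ltr_pM2l h0); apply: le_lt_trans wide.
  have : `|h * z%:~R| <= `|g| + 2 * r + h.
    by rewrite -[h * _](subrK g) (le_trans (ler_normD _ _)) //; lra.
  by rewrite normrM (gtr0_norm h0); lra.
(* A stays away from the ends of the range of rep, where a step wraps around. *)
have rep_shift x (e : int) : x \in A -> `|e| <= 1 ->
    rep (x + e%:~R) = rep x + e.
  rewrite inE => /inner xA e1; rewrite -[x in LHS](repK repP) -intrD.
  by rewrite (rep_intr_lt repP) //; lia.
have aE x : a x = ((w ((h * (rep x)%:~R - g) / r))%:C)%C by [].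
have a_out x (e : int) : x \notin A -> `|e| <= 1 -> a (x + e%:~R) = 0.
  move=> xA e1; rewrite aE out ?rmorph0 // ltNge; apply: contra xA => near.
  have nearA : x + e%:~R \in A by rewrite inE; lra.
  have := rep_shift (x + e%:~R) (- e) nearA; rewrite normrN => /(_ e1).
  rewrite intrN addrK inE => ->; rewrite intrB.
  rewrite (_ : _ - g = h * (rep (x + e%:~R))%:~R - g - h * e%:~R); last by ring.
  apply: le_trans (ler_normB _ _) _; apply: lerD => //.
  rewrite normrM (gtr0_norm h0) -[leRHS]mulr1 ler_pM2l //.
  by rewrite -intr_norm -[1]/(1%:~R) ler_int.
have [D DE] : exists D : R, `|dft (residue_char M rep R) a n| = (D%:C)%C.
  by eexists; rewrite normc_def.
have D0 : 0 <= D by rewrite -ler0c -DE.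
have sum_near (b : F -> R[i]) (c : R) : 0 <= c ->
    (forall x, x \notin A -> b x = 0) -> (forall x, x \in A -> `|b x| <= (c%:C)%C) ->
    \sum_x `|b x| <= ((8 * (r / h) * c)%:C)%C.
  move=> c0 bout bin; rewrite (bigID (mem A)) /= [X in _ + X]big1 => [|x xA].
    rewrite addr0 (le_trans (ler_sum _ bin)) // sumr_const.
    by rewrite -rmorphMn lecR -[leLHS]mulr_natl ler_wpM2r.
  by rewrite bout // normr0.
have a0 x : x \notin A -> a x = 0.
  by move=> xA; have := a_out _ 0 xA; rewrite addr0; apply.
have D1 : D <= 8 * (r / h) * K.
  rewrite -lecR -DE; apply: le_trans (ler_norm_sum _ _ _) _.
  under eq_bigr => x _ do
    rewrite normrM (char_norm (residue_char_character repP R)) mulr1.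
  by apply: sum_near => // x _; rewrite aE normc_real lecR.
have u1 : 0 < h / r <= 1 by rewrite divr_gt0 //= ler_pdivrMr // mul1r.
have D2 : ((rep n)%:~R / M%:R) ^+ 2 * D <= 8 * (r / h) * (K * (h / r) ^+ 2).
  have /= := dft_second_difference a n (residue_char_character repP R).
  rewrite DE => dle; rewrite -lecR rmorphM; apply: le_trans (le_trans dle _).
    apply: ler_wpM2r; first by rewrite /= ler0c.
    exact: residue_char_chord.
  apply: sum_near => [|x xA|x xA].
  - by rewrite mulr_ge0 // sqr_ge0.
  - have := a_out _ 1 xA; have := a_out _ (-1) xA; rewrite intrN => -> // -> //.
    by rewrite a0 // addr0 mulr0 subr0.
  - have := rep_shift _ 1 xA; have := rep_shift _ (-1) xA.
    rewrite intrN => /(_ isT) rN /(_ isT) rP; rewrite !aE rN rP.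
    rewrite -[2 : R[i]](rmorph_nat (real_complex R)) -rmorphM -rmorphD -rmorphB.
    rewrite normc_real lecR.
    rewrite (_ : (h * (rep x + 1)%:~R - g) / r =
      (h * (rep x)%:~R - g) / r + h / r); last by rewrite intrD; ring.
    rewrite (_ : (h * (rep x + -1)%:~R - g) / r =
      (h * (rep x)%:~R - g) / r - h / r); last by rewrite intrB; ring.
    exact: wdiff.
rewrite DE lecR.
set t := r * `|_|; have [t1|t1] := leP t 1.
  by rewrite expr1n invr1 mulr1; lra.
rewrite ler_pdivlMr ?exprn_gt0 ?(lt_trans ltr01 t1) //.
have M0 : 0 < M%:R :> R by rewrite ltr0n -(card_residues repP);
  apply/card_gt0P; exists 0.
have -> : D * t ^+ 2 = ((rep n)%:~R / M%:R) ^+ 2 * D * (r / h) ^+ 2.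
  rewrite /t exprMn real_normK ?num_real //.
  by field; rewrite !gt_eqF.
apply: le_trans (ler_wpM2r (sqr_ge0 _) D2) _.
rewrite le_eqVlt; apply/orP; left; apply/eqP.
by field; rewrite !gt_eqF.
Qed.

(** * Periodization of lattice sums *)

Definition grid_point k q (c : 'cV['I_(q.*2.+1)]_k) : 'cV[int]_k :=
  \col_i ((c i 0 : nat)%:Z - q%:Z).

Lemma grid_point_inj k q : injective (@grid_point k q).
Proof.
move=> c c' /colP cc; apply/colP => i; apply: ord_inj.
by have := cc i; rewrite !mxE; lia.
Qed.

Lemma grid_point_le k q (c : 'cV['I_(q.*2.+1)]_k) i :
  `|grid_point c i 0| <= q%:Z.
Proof. by rewrite mxE; have := ltn_ord (c i 0); lia. Qed.

Lemma grid_pointP k q (y : 'cV[int]_k) :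
  (forall i, `|y i 0| <= q%:Z) -> exists c, y = grid_point (q := q) c.
Proof.
move=> yq; exists (\col_i inord (absz (y i 0 + q%:Z))).
apply/colP => i; rewrite !mxE inordK; have := yq i; lia.
Qed.

Lemma dvdz_col k (x : 'cV[int]_k) :
  (forall i, (M %| x i 0%R)%Z) -> exists t : 'cV[int]_k, x = M%:Z *: t.
Proof.
move=> Mx; exists (\col_i (x i 0%R %/ M)%Z); apply/colP => i.
by rewrite !mxE mulrC divzK.
Qed.

(** Since U *m B = M, the lattice h U Z^k contains h M Z^k, and the image of
    U modulo M is this lattice modulo its period. The points that matter are
    those of the grid [-q, q]^k: by inner it contains all the points in the
    support of the f i, and by wide it has no two points that
    agree modulo M. Each residue is hit #|ker U| = |det U| times. *)
Lemma sum_periodized k (U B : 'M[int]_k) (f : 'I_k -> R -> R) (h G : R) q :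
  (0 < M)%N -> U *m B = (M%:Z)%:M ->
  (forall i x, G < `|x| -> f i x = 0) ->
  (forall y : 'cV[int]_k, (forall i, `|h * ((U *m y) i 0)%:~R| <= G) ->
     forall i, `|y i 0| <= q%:Z) ->
  (forall y : 'cV[int]_k, (forall i, `|y i 0| <= q%:Z) ->
     forall i, 2 * `|(U *m y) i 0| < M%:Z) ->
  \sum_(z : 'cV[F]_k) \prod_i f i (h * (rep ((map_mx intr U *m z) i 0))%:~R) =
  `|\det U|%N%:R *
    \sum_(c : 'cV['I_(q.*2.+1)]_k) \prod_i f i (h * ((U *m grid_point c) i 0)%:~R).
Proof.
move=> M0 UB fG inner wide; pose Ub : 'M[F]_k := map_mx intr U.
pose W (c : 'cV['I_(q.*2.+1)]_k) := \prod_i f i (h * ((U *m grid_point c) i 0)%:~R).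
pose lift (y : 'cV[int]_k) : 'cV[F]_k := map_mx intr y.
have UliftE y i : (Ub *m lift y) i 0 = ((U *m y) i 0)%:~R.
  by rewrite -map_mxM mxE.
have repU c i : rep ((Ub *m lift (grid_point c)) i 0) = (U *m grid_point (q := q) c) i 0.
  by rewrite UliftE (rep_intr_lt repP) // wide // => j; exact: grid_point_le.
have detU : \det U != 0.
  have : \det (U *m B) != 0 by rewrite UB det_scalar expf_neq0 // -lt0n.
  by rewrite det_mulmx mulf_eq0 negb_or => /andP[].
have Uinj (y y' : 'cV[int]_k) : U *m y = U *m y' -> y = y'.
  move=> /(congr1 (mulmx (\adj U))); rewrite !mulmxA mul_adj_mx !mul_scalar_mx.
  by move/colP => yy; apply/colP => i; have := yy i; rewrite !mxE => /(mulfI detU).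
have Ubinj c c' :
    Ub *m lift (grid_point (q := q) c) = Ub *m lift (grid_point c') -> c = c'.
  move=> cc; apply: (@grid_point_inj k q); apply: Uinj; apply/colP => i.
  by rewrite -!repU cc.
have pointwise z : \prod_i f i (h * (rep ((Ub *m z) i 0))%:~R) =
    \sum_c W c * (Ub *m z == Ub *m lift (grid_point c))%:R.
  have [/existsP[c /eqP zc]|/existsPn none] :=
      boolP [exists c : 'cV['I_(q.*2.+1)]_k, Ub *m z == Ub *m lift (grid_point c)].
    rewrite (bigD1 c) //= zc eqxx mulr1 [X in _ + X]big1 ?addr0 => [|c' c'c].
      by apply: eq_bigr => i _; rewrite repU.
    by case: eqP => [/Ubinj /esym /eqP|_]; rewrite ?(negbTE c'c) ?mulr0.
  rewrite [RHS]big1 => [|c _]; last by rewrite (negbTE (none c)) mulr0.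
  apply/eqP/negP => /negP nz.
  have near i : `|h * (rep ((Ub *m z) i 0))%:~R| <= G.
    rewrite leNgt; apply: contra nz => far.
    by rewrite (bigD1 i) //= fG // mul0r.
  pose x : 'cV[int]_k := \col_i rep ((Ub *m z) i 0).
  pose z' : 'cV[int]_k := \col_i rep (z i 0).
  have z'K : lift z' = z by apply/colP => i; rewrite !mxE (repK repP).
  have [t tE] : exists t : 'cV[int]_k, U *m z' - x = M%:Z *: t.
    apply: dvdz_col => i; rewrite -(intr_eq0_dvd repP).
    have -> : (U *m z' - x) i 0 = (U *m z') i 0 - rep ((Ub *m z) i 0).
      by rewrite [LHS]mxE; congr (_ + _); rewrite [LHS]mxE; congr (- _); rewrite mxE.
    by rewrite intrB (repK repP) -z'K UliftE subrr.
  have xU : x = U *m (z' - B *m t).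
    by rewrite mulmxBr mulmxA UB mul_scalar_mx -tE opprB addrC subrK.
  have [c cE] : exists c, z' - B *m t = grid_point (q := q) c.
    apply: grid_pointP; apply: inner => i.
    by rewrite -xU mxE.
  have /negP := none c; apply; apply/eqP/colP => i.
  by rewrite UliftE -cE -xU [x i 0]mxE (repK repP).
rewrite (eq_bigr _ (fun z _ => pointwise z)) exchange_big mulr_sumr /=.
apply: eq_bigr => c _; rewrite -mulr_sumr mulrC; congr (_ * _).
rewrite -(card_kernel_map_intr (@card_torsion _ _ _ repP) UB) -sum1_card natr_sum.
rewrite [RHS]big_mkcond /= (reindex_inj (addIr (lift (grid_point c)))) /=.
apply: eq_bigr => z _; rewrite inE mulmxDr -subr_eq0 addrK.
by case: eqP.
Qed.

End SampledSums.

(** * Poisson summation for rational lattices *)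

(** If U *m B = M and h * M = T, these are the points of the dual of the
    lattice h U Z^k. *)
Definition scaled_dual_point (R : realType) k (B : 'M[int]_k) (T : R)
  (m : 'cV[int]_k) : 'cV[R]_k := \col_i (((B^T *m m) i 0)%:~R / T).

Section SampledPoisson.
Variables (R : realType) (F : finComUnitRingType) (M : nat) (rep : F -> int).
Hypothesis repP : centered_residues M rep.

(** If U^T x = M t with x integral, then M x = B^T U^T x = M (B^T t). *)
Lemma kernel_dual_point k (U B : 'M[int]_k) (n : 'cV[F]_k) :
  (0 < M)%N -> U *m B = (M%:Z)%:M -> (map_mx intr U)^T *m n = 0 ->
  exists m, \col_i rep (n i 0) = B^T *m m.
Proof.
move=> M0 UB Un; pose x : 'cV[int]_k := \col_i rep (n i 0).
have xK : map_mx intr x = n by apply/colP => i; rewrite !mxE (repK repP).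
have [t tE] : exists t : 'cV[int]_k, U^T *m x = M%:Z *: t.
  apply: (dvdz_col) => i; rewrite -(intr_eq0_dvd repP).
  have := Un; rewrite -xK map_trmx -map_mxM => /colP/(_ i).
  by rewrite [LHS]mxE => ->; rewrite mxE.
exists t; apply/colP => i; have Mz0 : M%:Z != 0 by rewrite -lt0n.
apply: (mulfI Mz0); have : B^T *m (U^T *m x) = M%:Z *: (B^T *m t).
  by rewrite tE -scalemxAr.
rewrite mulmxA -trmx_mul UB tr_scalar_mx mul_scalar_mx => /colP/(_ i).
have scE (y : 'cV[int]_k) : (M%:Z *: y) i 0 = M%:Z * y i 0 by rewrite mxE.
by rewrite !scE.
Qed.

(** In the identity of [sum_mulmx_dft], the frequency 0 gives the
    main term. A non-zero frequency n is T times a non-zero dual point, with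
    Fourier coefficients bounded by [dft_sample_decay], and
    [dual_sum_bound] sums them. The factor |det B| / T^k is |det U|^-1 after
    normalization by h^k; it is the density of the lattice h U Z^k. *)
Lemma sampled_poisson_error d (U B : 'M[int]_d.+1) (w : 'I_d.+1 -> R -> R)
    (K G H Phi h : R) (g r : 'I_d.+1 -> R) q :
  let T := h * M%:R in
  let f i x := w i ((x - g i) / r i) in
  (0 < M)%N -> U *m B = (M%:Z)%:M ->
  0 <= K -> (forall i x, `|w i x| <= K) ->
  (forall i x, 2 < `|x| -> w i x = 0) ->
  (forall i x u, 0 < u <= 1 ->
     `|w i (x + u) + w i (x - u) - 2 * w i x| <= K * u ^+ 2) ->
  (forall i, 0 < h <= r i) ->
  (forall i, `|g i| + 2 * r i <= G) -> 2 * (G + 2 * h) < T ->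
  (forall y : 'cV[int]_d.+1, (forall i, `|h * ((U *m y) i 0)%:~R| <= G) ->
     forall i, `|y i 0| <= q%:Z) ->
  (forall y : 'cV[int]_d.+1, (forall i, `|y i 0| <= q%:Z) ->
     forall i, 2 * `|(U *m y) i 0| < M%:Z) ->
  1 <= H -> 0 < Phi -> H * Phi = r ord_max ->
  (forall i, r (widen_ord (leqnSn d) i) <= 1) ->
  (forall m, m != 0 -> let v := scaled_dual_point B T m in
     height (initv v) <= H -> 1 / Phi <= height (initv v) * `|lastv v|) ->
  `|\sum_(c : 'cV['I_(q.*2.+1)]_d.+1)
       \prod_i f i (h * ((U *m grid_point c) i 0)%:~R)
     - `|\det B|%N%:R / T ^+ d.+1
       * \prod_i (h * \sum_x f i (h * (rep x)%:~R))|
  <= `|\det B|%N%:R / T ^+ d.+1 * ((8 * K) ^+ d.+1 * (2 * 32 ^+ d.+1 * Phi)).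
Proof.
move=> T f M0 UB K0 wK w0 wdiff hr gG wideT inner wide H1 Phi0 HPhi r1 dioph.
have h0 : 0 < h by have /andP[] := hr ord_max.
have r0 i : 0 < r i by have /andP[h0' /(lt_le_trans h0')] := hr i.
have T0 : 0 < T by rewrite mulr_gt0 // ltr0n.
set S := \sum_c _; set P := `|\det B|%N%:R.
set main := \prod_i _.
have MUB : `|\det U|%N%:R * P = M%:R ^+ d.+1 :> R.
  rewrite -natrM -abszM -det_mulmx UB det_scalar abszX -natrX; congr (_%:R).
have U0 : 0 < `|\det U|%N%:R :> R.
  rewrite ltr0n absz_gt0; apply: contraTneq isT => U0; move: MUB.
  rewrite U0 absz0 mul0r => /esym/eqP; rewrite expf_eq0 /= pnatr_eq0.
  by rewrite (gtn_eqF M0).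
pose a i : F -> R[i] := sample rep (f i) h.
pose ker := [pred n : 'cV[F]_d.+1 | ((map_mx intr U)^T *m n == 0) && (n != 0)].
pose E : R[i] := \sum_(n in ker) \prod_i dft (residue_char M rep R) (a i) (n i 0).
have SE : ((`|\det U|%N%:R * S)%:C)%C =
    ((\prod_i \sum_x f i (h * (rep x)%:~R))%:C)%C + E.
  have -> : `|\det U|%N%:R * S = \sum_(z : 'cV[F]_d.+1)
      \prod_i f i (h * (rep ((map_mx intr U *m z) i 0))%:~R).
    rewrite (sum_periodized repP M0 UB _ inner wide) // => i x Gx.
    rewrite /f w0 // normrM normfV (gtr0_norm (r0 i)) ltr_pdivlMr //.
    have := gG i; have := ler_normD (x - g i) (g i); rewrite subrK; lra.
  rewrite rmorph_sum /=.
  under eq_bigr => z _ do rewrite rmorph_prod /=.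
  rewrite (sum_mulmx_dft _ a (residue_char_character repP R)).
  rewrite (bigD1 0) /= ?mulmx0 ?eqxx //; congr (_ + _).
  rewrite rmorph_prod; apply: eq_bigr => i _; rewrite mxE /dft rmorph_sum /=.
  apply: eq_bigr => x _.
  by rewrite mul0r oppr0 (char0 (residue_char_character repP R)) mulr1.
have Ebound : `|E| <= (((8 * K / h) ^+ d.+1 * (2 * 32 ^+ d.+1 * Phi))%:C)%C.
  pose lam (n : {n in ker}) : 'cV[R]_d.+1 :=
    \col_i ((rep (val n i 0))%:~R / T).
  have lamP (n : {n in ker}) : exists2 m, \col_i rep (val n i 0) = B^T *m m &
      lam n = scaled_dual_point B T m.
    have := valP n; rewrite inE => /andP[/eqP nker _].
    have [m mE] := kernel_dual_point M0 UB nker; exists m => //.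
    by apply/colP => i; rewrite [LHS]mxE [RHS]mxE -mE [in RHS]mxE.
  have := @dual_sum_bound R d _ lam H Phi r H1 Phi0 HPhi.
  move=> bound; have {}bound : \sum_n \prod_j (Num.max 1 (r j * `|lam n j 0|)) ^- 2
      * \prod_j r j <= 2 * 32 ^+ d.+1 * Phi.
    apply: bound => [n|n n' nn'|j]; last by rewrite r0 r1.
    - have [m mE ->] := lamP n; apply: dioph.
      apply: contraTneq (valP n) => m0; rewrite inE negb_and negbK.
      apply/orP; right; apply/eqP/colP => i; apply: (rep_inj repP).
      rewrite [in RHS]mxE (rep0 repP M0).
      by have /colP/(_ i) := mE; rewrite m0 mulmx0 [LHS]mxE [RHS]mxE.
    - have [m mE ->] := lamP n; have [m' mE' ->] := lamP n'.
      have -> : scaled_dual_point B T m - scaled_dual_point B T m' =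
          scaled_dual_point B T (m - m').
        apply/colP => i; rewrite !mxE -mulrBl -intrB; congr (_%:~R / _).
        by rewrite -sumrB; apply: eq_bigr => j _; rewrite !mxE mulrBr.
      apply: dioph; apply: contra nn'; rewrite subr_eq0 => /eqP mm'.
      apply/eqP/val_inj/colP => i; apply: (rep_inj repP).
      have /colP/(_ i) := mE; have /colP/(_ i) := mE'; rewrite mm' => <-.
      by rewrite !mxE.
  rewrite /E big_sub; apply: le_trans (ler_norm_sum _ _ _) _.
  apply: (@le_trans _ _ (\sum_(n : {n in ker})
    (((8 * K / h) ^+ d.+1 * (\prod_j (Num.max 1 (r j * `|lam n j 0|)) ^- 2
      * \prod_j r j))%:C)%C)).
    apply: ler_sum => n _; rewrite normr_prod.
    have -> : (8 * K / h) ^+ d.+1 * (\prod_j (Num.max 1 (r j * `|lam n j 0|)) ^- 2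
      * \prod_j r j) = \prod_j (8 * K * (r j / h) *
        (Num.max 1 (r j * `|lam n j 0|)) ^- 2).
      have -> : (8 * K / h) ^+ d.+1 = \prod_(j < d.+1) (8 * K / h).
        by rewrite prodr_const card_ord.
      by rewrite -!big_split /=; apply: eq_bigr => j _; ring.
    rewrite rmorph_prod; apply: ler_prod => j _; rewrite normr_ge0 /= mxE.
    apply: dft_sample_decay => //; [exact: w0 | exact: wdiff |].
    by have := gG j; move: wideT; rewrite /T; lra.
  rewrite -rmorph_sum lecR -mulr_sumr ler_wpM2l //.
  by rewrite exprn_ge0 // divr_ge0 ?mulr_ge0 ?(ltW h0).
have -> : P / T ^+ d.+1 * main =
    P / M%:R ^+ d.+1 * \prod_i \sum_x f i (h * (rep x)%:~R).
  rewrite /main big_split /= prodr_const card_ord /T exprMn.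
  by field; rewrite !expf_neq0 ?pnatr_eq0 ?(gtn_eqF M0) ?gt_eqF.
have -> : S = P / M%:R ^+ d.+1 * (`|\det U|%N%:R * S).
  rewrite [RHS]mulrA [X in X * S]mulrAC (mulrC P) MUB divff ?mul1r //.
  by rewrite expf_neq0 // pnatr_eq0 (gtn_eqF M0).
rewrite -mulrBr normrM.
have -> : `|P / M%:R ^+ d.+1| = P / M%:R ^+ d.+1.
  by rewrite ger0_norm // divr_ge0 ?ler0n ?exprn_ge0.
have -> : P / T ^+ d.+1 * ((8 * K) ^+ d.+1 * (2 * 32 ^+ d.+1 * Phi)) =
  P / M%:R ^+ d.+1 * ((8 * K / h) ^+ d.+1 * (2 * 32 ^+ d.+1 * Phi)).
  rewrite /T !exprMn exprVn.
  by field; rewrite !expf_neq0 ?pnatr_eq0 ?(gtn_eqF M0) ?gt_eqF.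
rewrite ler_wpM2l ?divr_ge0 ?ler0n ?exprn_ge0 // -lecR -normc_real.
by rewrite rmorphB /= SE addrC addKr.
Qed.
End SampledPoisson.

(** * Bumps and their Riemann sums *)

(** What the argument uses of a twice continuously differentiable weight
    supported in [-2, 2]; the last two bounds replace those on its
    first and second derivatives. *)
Definition compact_bump (R : realType) (K : R) (f : R -> R) : Prop :=
  [/\ continuous f,
      forall x, `|f x| <= K,
      forall x, 2 < `|x| -> f x = 0,
      forall x u, 0 <= u <= 1 -> `|f (x + u) - f x| <= K * u
    & forall x u, 0 < u <= 1 ->
        `|f (x + u) + f (x - u) - 2 * f x| <= K * u ^+ 2].

Lemma bounded_on_segment (R : realType) (g : R -> R) : continuous g ->
  exists2 K : R, 0 <= K & forall x, `|x| <= 4 -> `|g x| <= K.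
Proof.
move=> cg; have [||c _ cmax] := @EVT_max R (fun x => `|g x|) (-4) 4.
- by lra.
- apply: continuous_subspaceT => x; apply: continuous_comp; first exact: cg.
  exact: norm_continuous.
exists `|g c| => // x; rewrite ler_norml => x4; apply: cmax.
by rewrite in_itv.
Qed.

Lemma smooth_compact_bump (R : realType) (l : nat) (f : R -> R) :
  (2 <= l)%N -> continuously_differentiable l f -> supp f `<=` `[-2, 2] ->
  exists2 K : R, 0 <= K & compact_bump K f.
Proof.
move=> l2 [fd fc] fsupp; pose f1 : R -> R := derive1 f; pose f2 : R -> R := derive1 f1.
have d0 (x : R) : derivable f x 1 by apply: (fd 0%N); lia.
have d1 (x : R) : derivable f1 x 1 by apply: (fd 1%N); lia.
have c0 : continuous f by move=> x; exact/differentiable_continuous/derivable1_diffP.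
have c1 : continuous f1.
  by move=> x; exact/differentiable_continuous/derivable1_diffP.
have c2 : continuous f2.
  have [l2'|l2'] := ltnP 2 l; last first.
    by have -> : f2 = derive1n l f by have -> : l = 2%N by lia.
  by move=> x; apply/differentiable_continuous/derivable1_diffP/(fd 2%N).
have [K0 K00 K0P] := bounded_on_segment c0.
have [K1 K10 K1P] := bounded_on_segment c1.
have [K2 K20 K2P] := bounded_on_segment c2.
have f0 x : 2 < `|x| -> f x = 0.
  move=> x2; apply: contraTeq x2 => fx; rewrite -leNgt ler_norml.
  by have := fsupp x; rewrite /= in_itv /=; apply; exact: subset_closure.
have D0 (x : R) : is_derive x 1 f (f1 x) by rewrite /f1 derive1E; exact/derivableP.
have D1 (x : R) : is_derive x 1 f1 (f2 x).
  by rewrite /f2 derive1E; exact/derivableP.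
have mvt (g g' : R -> R) (a b : R) : (forall x : R, is_derive x 1 g (g' x)) -> a <= b ->
    exists2 c, a <= c <= b & g b - g a = g' c * (b - a).
  move=> Dg ab; have [|c] := @MVT_segment R g g' a b ab (fun x _ => Dg x).
    apply: continuous_subspaceT => x; apply/differentiable_continuous.
    by apply/derivable1_diffP; case: (Dg x).
  by rewrite in_itv /=; exists c.
(* From |x| <= 3, steps of length at most 1 stay in [-4, 4], where the bounds
   K1 and K2 hold; from |x| > 3, they stay outside of the support. *)
have far (x e : R) : 3 < `|x| -> `|e| <= 1 -> f (x + e) = 0.
  move=> x3 e1; apply: f0; have := ler_normB (x + e) e.
  by rewrite addrK; lra.
exists (K0 + K1 + 2 * K2); first lra.
split=> //.
- move=> x; have [x2|x2] := leP `|x| 4; first by have := K0P x x2; lra.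
  by rewrite f0 ?normr0; lra.
- move=> x u /andP[u0 u1]; have [x3|x3] := leP `|x| 3.
    have [|c /andP[c1' c2'] ->] := mvt f f1 x (x + u) D0; first lra.
    have c4 : `|c| <= 4 by move: x3; rewrite !ler_norml; lra.
    have -> : x + u - x = u by ring.
    by rewrite normrM (ger0_norm u0) ler_wpM2r //; have := K1P _ c4; lra.
  have := far x 0 x3; rewrite addr0 normr0 => -> //.
  have -> : f (x + u) = 0 by apply: far; rewrite // ger0_norm.
  by rewrite subrr normr0 mulr_ge0 //; lra.
- move=> x u /andP[u0 u1]; have [x3|x3] := leP `|x| 3; last first.
    have := far x 0 x3; rewrite addr0 normr0 => -> //.
    have -> : f (x + u) = 0 by apply: far; rewrite // gtr0_norm.
    have -> : f (x - u) = 0 by apply: far; rewrite // normrN gtr0_norm.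
    rewrite mulr0 addr0 subrr normr0.
    by rewrite mulr_ge0 ?sqr_ge0 //; lra.
  pose g t := f (x + t) + f (x - t).
  have Dg (t : R) : is_derive t 1 g (f1 (x + t) - f1 (x - t)).
    have Dp : is_derive t 1 (f \o (fun s => x + s)) (f1 (x + t) * (0 + 1)).
      by apply: is_derive1_comp; exact: D0.
    have Dm : is_derive t 1 (f \o (fun s => x - s)) (f1 (x - t) * (0 - 1)).
      by apply: is_derive1_comp; exact: D0.
    have := is_deriveD Dp Dm; rewrite add0r sub0r mulr1 mulrN1.
    exact.
  have [|c /andP[c1' c2']] := mvt _ _ 0 u Dg; first exact: ltW.
  rewrite /g addr0 !subr0 => e.
  have -> : f (x + u) + f (x - u) - 2 * f x =
    f (x + u) + f (x - u) - (f x + f x) by ring.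
  rewrite e; have [|b /andP[b1 b2] ->] := mvt _ _ (x - c) (x + c) D1; first lra.
  have b4 : `|b| <= 4 by move: x3; rewrite !ler_norml; lra.
  have -> : x + c - (x - c) = 2 * c by ring.
  rewrite !normrM (gtr0_norm u0) (ger0_norm c1') expr2 !mulrA.
  apply: ler_wpM2r; first exact: ltW.
  rewrite normr_nat; have := K2P _ b4; have := normr_ge0 (f2 b).
  nra.
Qed.

Lemma bump_primitive (R : realType) (K : R) (f : R -> R) : compact_bump K f ->
  exists Phi : R -> R, [/\ forall x : R, is_derive x 1 Phi (f x),
    forall x, x < -2 -> Phi x = 0 &
    forall x, 2 < x -> Phi x = \int[lebesgue_measure]_t f t].
Proof.
move=> [cf _ f0 _ _].
pose mu := @lebesgue_measure R.
have fE : f = f \_ `[-2, 2].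
  apply/funext => x; rewrite patchE; case: ifPn => // /negP xN; apply: f0.
  rewrite ltNge; apply/negP => x2; apply: xN; rewrite inE /= in_itv /=.
  by rewrite -ler_norml.
have intf : mu.-integrable setT (EFin \o f).
  have seg : mu.-integrable `[-2, 2] (EFin \o f).
    apply: continuous_compact_integrable; first exact: segment_compact.
    exact: continuous_subspaceT.
  by move: seg; rewrite integrable_mkcond //= restrict_EFin -fE.
exists (fun x => \int[mu]_(t in `]-oo, x]) f t); split=> [x|x x2|x x2].
- have [||||dF F'] := @continuous_FTC1 R f -oo%O x (x + 1).
  + by rewrite ltrDl.
  + exact: integrableS intf.
  + by rewrite ltNyr.
  + exact: cf.
  apply: DeriveDef; first exact: dF.
  by rewrite -derive1E; exact: F'.
- rewrite (@eq_Rintegral _ _ _ _ _ (fun=> 0)) => [|t].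
    by rewrite Rintegral_cst ?mul0r.
  rewrite inE /= in_itv /= => tx; apply: f0; rewrite lter_normr.
  by apply/orP; right; lra.
- rewrite Rintegral_mkcond; congr (Rintegral _ _ _); apply/funext => t.
  rewrite patchE; case: ifPn => // /negP tx; rewrite f0 // lter_normr.
  apply/orP; left; rewrite (lt_trans x2) // ltNge; apply/negP => tx'.
  by apply: tx; rewrite inE /= in_itv.
Qed.

(** The integral is the total increment of a primitive. On each step the
    increment is u times a value of f at distance at most u from the node. *)
Lemma riemann_sum_error (R : realType) (K : R) (f : R -> R) (x0 u : R) n :
  compact_bump K f -> 0 < u <= 1 -> x0 < -2 -> 2 < x0 + n%:R * u ->
  `|u * (\sum_(i < n) f (x0 + i%:R * u)) - \int[lebesgue_measure]_t f t|
    <= n%:R * (K * u ^+ 2).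
Proof.
move=> fP /andP[u0 u1] x02 xn2; have [Phi [DPhi Phi0 Phi1]] := bump_primitive fP.
have [_ _ _ flip _] := fP.
have step x : `|u * f x - (Phi (x + u) - Phi x)| <= K * u ^+ 2.
  have xu : x <= x + u by rewrite lerDl ltW.
  have [|c] := @MVT_segment R Phi f x (x + u) xu (fun y _ => DPhi y).
    apply: continuous_subspaceT => y; apply/differentiable_continuous.
    by apply/derivable1_diffP; case: (DPhi y).
  rewrite in_itv /= => /andP[xc cx] ->.
  rewrite (_ : _ - _ = - ((f (x + (c - x)) - f x) * u)); last first.
    by rewrite (_ : x + (c - x) = c); ring.
  rewrite normrN normrM (gtr0_norm u0) expr2 mulrA.
  apply: ler_wpM2r; first exact: ltW.
  have K0 : 0 <= K.
    by have := flip 0 1; rewrite ler01 lexx mulr1 => /(_ isT); apply: le_trans.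
  apply: le_trans (flip _ _ _) _; first lra.
  by apply: ler_wpM2l => //; lra.
have -> : \int[lebesgue_measure]_t f t =
    \sum_(i < n) (Phi (x0 + i%:R * u + u) - Phi (x0 + i%:R * u)).
  transitivity (Phi (x0 + n%:R * u) - Phi x0).
    by rewrite (Phi1 _ xn2) (Phi0 _ x02) subr0.
  elim: n {xn2} => [|m IH]; first by rewrite big_ord0 mul0r addr0 subrr.
  by rewrite big_ord_recr /= -IH -natr1 mulrDl mul1r addrA; ring.
rewrite mulr_sumr -sumrB; apply: le_trans (ler_norm_sum _ _ _) _.
rewrite -[n in n%:R]card_ord mulr_natl -sumr_const; apply: ler_sum => i _.
exact: step.
Qed.

Lemma sampled_mass_error (R : realType) (F : finComUnitRingType) (M : nat)
    (rep : F -> int) (K : R) (w : R -> R) (g r h : R) :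
  centered_residues M rep -> compact_bump K w -> 0 < h <= r ->
  2 * (`|g| + 2 * r + 2 * h) < h * M%:R ->
  `|h * \sum_x w ((h * (rep x)%:~R - g) / r)
     - r * \int[lebesgue_measure]_t w t| <= h * M%:R * K * (h / r).
Proof.
move=> repP wP /andP[h0 hr] wide; have r0 : 0 < r by exact: lt_le_trans hr.
rewrite (sum_rep repP (fun z => w ((h * z%:~R - g) / r))).
have Mlo : (M%:R - 1) / 2 <= (M./2)%:R :> R.
  have : (M <= (M./2).*2.+1)%N by lia.
  by rewrite -(ler_nat R) -natr1 -muln2 natrM; lra.
have Mhi : (M./2)%:R <= M%:R / 2 :> R.
  have : ((M./2).*2 <= M)%N by lia.
  by rewrite -(ler_nat R) -muln2 natrM; lra.
have [g1 g2] : - `|g| <= g /\ g <= `|g|.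
  by rewrite ler_norm lerNl -normrN ler_norm.
(* The nodes are the residues in increasing order, starting from - M./2. *)
pose x0 := (- (h * (M./2)%:R) - g) / r.
have := @riemann_sum_error R K w x0 (h / r) M wP.
rewrite (eq_bigr (fun i : 'I_M => w ((h * (i%:Z - (M./2)%:Z)%:~R - g) / r))); last first.
  move=> i _; congr w; rewrite intrB /x0 -![_%:~R]/(_%:R).
  by field; rewrite gt_eqF.
move=> riem; have {riem} : `|h / r * (\sum_(i < M)
    w ((h * (i%:Z - (M./2)%:Z)%:~R - g) / r)) -
    \int[lebesgue_measure]_t w t| <= M%:R * (K * (h / r) ^+ 2).
  apply: riem.
  - by rewrite divr_gt0 //= ler_pdivrMr // mul1r.
  - rewrite /x0 ltr_pdivrMr //; nra.
  - rewrite /x0 (_ : _ + _ = (h * M%:R - h * (M./2)%:R - g) / r); last first.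
      by field; rewrite gt_eqF.
    rewrite ltr_pdivlMr //; nra.
set s := \sum_(_ < _) _; set I := Rintegral _ _ _ => err.
have -> : h * s - r * I = r * (h / r * s - I) by field; rewrite gt_eqF.
rewrite normrM (gtr0_norm r0).
have -> : h * M%:R * K * (h / r) = r * (M%:R * (K * (h / r) ^+ 2)).
  by field; rewrite gt_eqF.
by rewrite ler_pM2l.
Qed.

(** * Limits of matrices and rational lattices *)

Lemma cvg_sumr (R : realType) (I : finType) (P : pred I) (f : I -> nat -> R)
    (l : I -> R) :
  (forall i, f i n @[n --> \oo] --> l i) ->
  (\sum_(i | P i) f i n) @[n --> \oo] --> \sum_(i | P i) l i.
Proof. by move=> fl; apply: cvg_big => [x|i _]; [exact: add_continuous|exact: fl]. Qed.

Lemma cvg_prodr (R : realType) (I : finType) (f : I -> nat -> R) (l : I -> R) :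
  (forall i, f i n @[n --> \oo] --> l i) ->
  (\prod_i f i n) @[n --> \oo] --> \prod_i l i.
Proof. by move=> fl; apply: cvg_big => [x|i _]; [exact: mul_continuous|exact: fl]. Qed.

Lemma cvg_mulmx (R : realType) m k p (V : nat -> 'M[R]_(m, k)) (W : 'M[R]_(m, k))
    (X : 'M[R]_(k, p)) :
  (forall i j, V n i j @[n --> \oo] --> W i j) ->
  forall i j, (V n *m X) i j @[n --> \oo] --> (W *m X) i j.
Proof.
move=> VW i j; rewrite mxE; under eq_fun => n do rewrite mxE.
by apply: cvg_sumr => a; apply: cvgM; [exact: VW | exact: cvg_cst].
Qed.

Lemma cvg_det (R : realType) k (V : nat -> 'M[R]_k) (W : 'M[R]_k) :
  (forall i j, V n i j @[n --> \oo] --> W i j) ->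
  \det (V n) @[n --> \oo] --> \det W.
Proof.
move=> VW; apply: cvg_sumr => s; apply: cvgM; first exact: cvg_cst.
by apply: cvg_prodr => i; exact: VW.
Qed.

(** Determinants and cofactors are polynomials in the entries. *)
Lemma cvg_invmx (R : realType) k (V : nat -> 'M[R]_k) (W : 'M[R]_k) :
  W \in unitmx -> (forall i j, V n i j @[n --> \oo] --> W i j) ->
  (\forall n \near \oo, V n \in unitmx) /\
  forall i j, (invmx (V n)) i j @[n --> \oo] --> (invmx W) i j.
Proof.
move=> Wu VW; have detVW := cvg_det VW.
have W0 : \det W != 0 by rewrite -unitfE -unitmxE.
have Vu : \forall n \near \oo, V n \in unitmx.
  by near=> n; rewrite unitmxE unitfE; near: n; exact: cvgr_neq0 detVW W0.
split=> // i j; rewrite /invmx Wu mxE.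
have adj : (\adj (V n)) i j @[n --> \oo] --> (\adj W) i j.
  rewrite mxE; under eq_fun => n do rewrite mxE.
  apply: cvgM; first exact: cvg_cst.
  by apply: cvg_det => a b; rewrite !mxE; under eq_fun => n do rewrite !mxE; exact: VW.
apply: (cvg_trans _ (cvgM (cvgV W0 detVW) adj)); apply: near_eq_cvg.
by apply: filterS Vu => n Vn; rewrite /= Vn [RHS]mxE.
Unshelve. all: by end_near. Qed.

Lemma cvg_harmonic_cst (R : realType) (c : R) :
  c / n.+1%:R @[n --> \oo] --> (0 : R).
Proof.
rewrite -[X in _ --> X](mulr0 c); apply: cvgM; first exact: cvg_cst.
exact: cvg_harmonic.
Qed.

Lemma near_large (R : realType) (c : R) : \forall n \near \oo, c < n.+1%:R.
Proof.
near=> n; have : c / n.+1%:R < 1.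
  by near: n; exact: cvgr_lt (cvg_harmonic_cst c) _ ltr01.
by rewrite ltr_pdivrMr // mul1r.
Unshelve. all: by end_near. Qed.

Definition rational_approx (R : realType) k (A : 'M[R]_k) (T : nat) : 'M[int]_k :=
  \matrix_(i, j) Num.floor (T%:R * A i j).

Definition int_quotient (R : realType) k (B : 'M[int]_k) (T : nat) : 'M[R]_k :=
  T%:R^-1 *: map_mx intr B.

Lemma cvg_rational_approx (R : realType) k (A : 'M[R]_k) i j :
  (int_quotient R (rational_approx A n.+1) n.+1) i j @[n --> \oo] --> A i j.
Proof.
have lo : A i j - 1 / n.+1%:R @[n --> \oo] --> A i j.
  rewrite -[X in _ --> X]subr0; apply: cvgB; first exact: cvg_cst.
  exact: cvg_harmonic_cst.
apply: (squeeze_cvgr _ lo (cvg_cst (A i j))); near=> n.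
rewrite !mxE ler_pdivlMl // ler_pdivrMl // mulrBr mulrCA divff ?pnatr_eq0 //.
have /andP[f1 f2] := floor_itv (n.+1%:R * A i j).
by rewrite f1 andbT; rewrite intrD in f2; lra.
Unshelve. all: by end_near. Qed.

Lemma norm_mulmx_le (R : realType) k (X : 'M[R]_k) (y : 'cV[R]_k) (a b : R) i :
  (forall i j, `|X i j| <= a) -> (forall j, `|y j 0| <= b) ->
  `|(X *m y) i 0| <= k%:R * (a * b).
Proof.
move=> Xa yb; rewrite mxE; apply: le_trans (ler_norm_sum _ _ _) _.
rewrite -[k in k%:R]card_ord mulr_natl -sumr_const; apply: ler_sum => j _.
by rewrite normrM ler_pM.
Qed.

(** Instance of [sampled_poisson_error] for the lattice T B^-1 Z^k, whose
    dual is generated by V^T. With M = |det B| T^3 the matrix U = M B^-1 is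
    integral, and the mesh h = T / M is at most T^-2, so that the error
    T K h / r of the Riemann sums tends to 0 when T grows. *)
Lemma rational_lattice_bound (R : realType) d (B : 'M[int]_d.+1) (T q : nat)
    (w : 'I_d.+1 -> R -> R) (K G H Phi a b : R) (g r : 'I_d.+1 -> R) :
  let V : 'M[R]_d.+1 := int_quotient R B T in
  let f i x := w i ((x - g i) / r i) in
  V \in unitmx -> (forall i j, `|V i j| <= b) ->
  (forall i j, `|invmx V i j| <= a) ->
  0 <= K -> (forall i, compact_bump K (w i)) ->
  (forall i, 0 < r i /\ T%:R^-1 <= r i) ->
  (forall i, `|g i| + 2 * r i <= G) -> 2 * (G + 2) < T%:R ->
  d.+1%:R * (b * G) <= q%:R -> 2 * (d.+1%:R * (a * q%:R)) < T%:R ->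
  1 <= H -> 0 < Phi -> H * Phi = r ord_max ->
  (forall i, r (widen_ord (leqnSn d) i) <= 1) ->
  (forall m : 'cV[int]_d.+1, m != 0 ->
     let v : 'cV[R]_d.+1 := V^T *m map_mx intr m in
     height (initv v) <= H -> 1 / Phi <= height (initv v) * `|lastv v|) ->
  exists2 mu : 'I_d.+1 -> R,
    forall i, `|mu i - r i * \int[lebesgue_measure]_t w i t| <= K / r i / T%:R &
    `|\sum_(c : 'cV['I_(q.*2.+1)]_d.+1)
         \prod_i f i ((invmx V *m map_mx intr (grid_point c)) i 0)
       - `|\det V| * \prod_i mu i|
    <= `|\det V| * ((8 * K) ^+ d.+1 * (2 * 32 ^+ d.+1 * Phi)).
Proof.
move=> V f Vu Vb Va K0 wP rT gG GT qG aqT H1 Phi0 HPhi r1 dioph.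
have r0 i : 0 < r i by have [] := rT i.
have G0 : 0 <= G.
  by apply: le_trans (gG ord_max); rewrite addr_ge0 // mulr_ge0 // ltW.
have T4 : 4 < T%:R :> R by lra.
have T0 : 0 < T%:R :> R by lra.
have Tn : (4 < T)%N by rewrite -(ltr_nat R).
have detVE : \det V = (\det B)%:~R / T%:R ^+ d.+1.
  by rewrite /V /int_quotient detZ det_map_mx exprVn mulrC.
have detB : \det B != 0.
  apply: contraTneq Vu => B0; rewrite unitmxE detVE B0 mul0r.
  by rewrite unitr0.
pose P := `|\det B|%N; have P0 : (0 < P)%N by rewrite absz_gt0.
pose M := (P * T ^ 3)%N.
have M0 : (0 < M)%N by rewrite muln_gt0 P0 expn_gt0 (ltn_trans _ Tn).
have M1 : (1 < M)%N.
  rewrite (leq_trans _ (leq_pmull _ P0)) // -(exp1n 3) ltn_exp2r //.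
  by rewrite (ltn_trans _ Tn).
(* U = M B^-1; the sign makes M positive. *)
pose U : 'M[int]_d.+1 := (sgz (\det B) * (T ^ 3)%:Z) *: \adj B.
have sM : sgz (\det B) * (T ^ 3)%:Z * \det B = M%:Z.
  by rewrite mulrAC -abszEsg /M PoszM.
have UB : U *m B = (M%:Z)%:M.
  by rewrite /U -scalemxAl mul_adj_mx -mul_scalar_mx -scalar_mxM sM.
have BU : B *m U = (M%:Z)%:M.
  by rewrite /U -scalemxAr mul_mx_adj -mul_scalar_mx -scalar_mxM sM.
pose h : R := T%:R / M%:R.
have M0R : 0 < M%:R :> R by rewrite ltr0n.
have h0 : 0 < h by rewrite divr_gt0.
have hM : h * M%:R = T%:R by rewrite divfK // gt_eqF.
have hT : h <= T%:R^-1 / T%:R.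
  rewrite /h /M natrM natrX.
  have P0R : 0 < P%:R :> R by rewrite ltr0n.
  have -> : T%:R / (P%:R * T%:R ^+ 3) = T%:R^-1 / T%:R / P%:R :> R.
    by field; rewrite !gt_eqF.
  have T20 : 0 <= T%:R^-1 / T%:R :> R by rewrite divr_ge0 ?invr_ge0 ?(ltW T0).
  by rewrite ler_piMr // invf_le1 // ler1n.
have h1 : h <= T%:R^-1.
  apply: le_trans hT _; rewrite ler_piMr ?invr_ge0 ?(ltW T0) // invf_le1 //; lra.
have h1' : h <= 1 by apply: le_trans h1 _; rewrite invf_le1 //; lra.
have QE (y : 'cV[int]_d.+1) i :
    (invmx V *m map_mx intr y) i 0 = h * ((U *m y) i 0)%:~R.
  have VhU : V *m (h *: map_mx intr U) = 1%:M.
    rewrite /V /int_quotient -scalemxAl -scalemxAr -map_mxM BU map_scalar_mx.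
    by rewrite !scale_scalar_mx /= -pmulrn hM mulVf // gt_eqF.
  have -> : invmx V = h *: map_mx intr U.
    by rewrite -[RHS]mul1mx -(mulVmx Vu) -mulmxA VhU mulmx1.
  by rewrite -scalemxAl mxE -map_mxM mxE.
have [F [rep repP]] : exists (F : finComUnitRingType) (rep : F -> int),
    centered_residues M rep.
  by exists 'Z_M, (@Zp_rep M); exact: Zp_centered_residues.
exists (fun i => h * \sum_x f i (h * (rep x)%:~R)).
  move=> i; have := @sampled_mass_error R F M rep K (w i) (g i) (r i) h repP (wP i).
  move=> err; apply: (le_trans (err _ _)).
  - by rewrite h0; have [_] := rT i; apply: le_trans.
  - by rewrite hM; have := gG i; lra.
  rewrite hM; have -> : K / r i / T%:R = T%:R * K * (T%:R^-1 / T%:R / r i).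
    by field; rewrite !gt_eqF.
  apply: ler_wpM2l; first by rewrite mulr_ge0 // (ltW T0).
  by rewrite ler_pM2r ?invr_gt0.
have := @sampled_poisson_error R F M rep repP d U B w K G H Phi h g r q M0 UB K0.
rewrite hM detVE normrM normfV -intr_norm.
have -> : `|T%:R ^+ d.+1| = T%:R ^+ d.+1 :> R by rewrite normrX normr_nat.
have -> : (`|\det B|)%:~R = `|\det B|%N%:R :> R by rewrite -abszE.
have -> : \sum_(c : 'cV['I_(q.*2.+1)]_d.+1)
      \prod_i f i ((invmx V *m map_mx intr (grid_point c)) i 0) =
    \sum_(c : 'cV['I_(q.*2.+1)]_d.+1)
      \prod_i f i (h * ((U *m grid_point c) i 0)%:~R).
  by apply: eq_bigr => c _; apply: eq_bigr => i _; rewrite QE.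
apply.
- by move=> i x; have [_ wK _ _ _] := wP i; exact: wK.
- by move=> i x; have [_ _ w0 _ _] := wP i; exact: w0.
- by move=> i x u; have [_ _ _ _ wd] := wP i; exact: wd.
- by move=> i; rewrite h0; have [_] := rT i; apply: le_trans.
- exact: gG.
- lra.
- move=> y yG i; rewrite -(ler_int R) intr_norm; apply: le_trans qG.
  have -> : (y i 0)%:~R = (V *m (invmx V *m map_mx intr y)) i 0 :> R.
    by rewrite mulmxA mulmxV // mul1mx mxE.
  by apply: norm_mulmx_le => // j; rewrite QE.
- move=> y yq i; rewrite -(ltr_int R) intrM intr_norm -(ltr_pM2l h0).
  rewrite -[M%:~R]/(M%:R) hM; apply: le_lt_trans aqT.
  have -> : h * (2%:~R * `|((U *m y) i 0)%:~R|) =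
      2 * `|h * ((U *m y) i 0)%:~R| by rewrite normrM (gtr0_norm h0); ring.
  rewrite ler_pM2l // -QE; apply: norm_mulmx_le => // j.
  by rewrite mxE -intr_norm -[q%:R]/(q%:~R) ler_int.
- exact: H1.
- exact: Phi0.
- exact: HPhi.
- exact: r1.
- move=> m m0; have -> : scaled_dual_point B T%:R m = V^T *m map_mx intr m.
    apply/colP => i; rewrite !mxE rmorph_sum mulr_suml /=.
    by apply: eq_bigr => j _; rewrite !mxE intrM; ring.
  exact: dioph.
Qed.

(** * Stability of the Diophantine condition *)

Lemma cvg_height (R : realType) d (v : nat -> 'cV[R]_d) (v0 : 'cV[R]_d) :
  (forall i, v n i 0 @[n --> \oo] --> v0 i 0) ->
  height (v n) @[n --> \oo] --> height v0.
Proof.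
move=> vv; apply: cvg_prodr => i; rewrite maxr_absE.
under eq_fun => n do rewrite maxr_absE.
have nv : `|v n i 0| @[n --> \oo] --> `|v0 i 0| by exact: cvg_norm.
apply: cvgM; last exact: cvg_cst.
apply: cvgD; first by apply: cvgD; [exact: cvg_cst|].
by apply: cvg_norm; apply: cvgB; [exact: cvg_cst|].
Qed.

Lemma height_ge1 (R : realType) d (v : 'cV[R]_d) : 1 <= height v.
Proof. by apply: prod_ge1 => i; rewrite le_max lexx. Qed.

Lemma coord_le_height (R : realType) d (v : 'cV[R]_d) i : `|v i 0| <= height v.
Proof.
rewrite /height (bigD1 i) //=.
apply: (@le_trans _ _ (Num.max 1 `|v i 0|)); first by rewrite le_max lexx orbT.
rewrite ler_peMr ?le_max ?ler01 //.
by apply: prod_ge1 => j; rewrite le_max lexx.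
Qed.

Lemma initv_widen (R : realType) d (v : 'cV[R]_d.+1) i :
  initv v i 0 = v (widen_ord (leqnSn d) i) 0.
Proof. by rewrite mxE. Qed.

(** A point v that violates the conclusion has all its coordinates bounded
    by H: the first d because of its height, the last because it is below 1,
    as 1 / Phi <= 1 <= height. So m = V^-T v lies in a finite set that does
    not depend on n, and for each m in it either the strict inequality or the
    strict bound H < height passes from W to V n for large n. *)
Lemma near_diophantine (R : realType) d (V : nat -> 'M[R]_d.+1)
    (W : 'M[R]_d.+1) (H Phi a : R) :
  1 <= H -> 1 <= Phi -> (forall i j, V n i j @[n --> \oo] --> W i j) ->
  (\forall n \near \oo, V n \in unitmx) ->
  (\forall n \near \oo, forall i j, `|invmx (V n) i j| <= a) ->
  (forall m : 'cV[int]_d.+1, m != 0 ->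
     let v : 'cV[R]_d.+1 := W^T *m map_mx intr m in
     height (initv v) <= H -> 1 / Phi < height (initv v) * `|lastv v|) ->
  \forall n \near \oo, forall m : 'cV[int]_d.+1, m != 0 ->
     let v : 'cV[R]_d.+1 := (V n)^T *m map_mx intr m in
     height (initv v) <= H -> 1 / Phi <= height (initv v) * `|lastv v|.
Proof.
move=> H1 Phi1 VW Vu Va dioph.
have Phi0 : 0 < Phi by exact: lt_le_trans Phi1.
pose q := (Num.truncn (d.+1%:R * (a * H))).+1.
have vcvg (m : 'cV[int]_d.+1) i :
    ((V n)^T *m map_mx intr m : 'cV[R]_d.+1) i 0 @[n --> \oo] -->
    (W^T *m map_mx intr m : 'cV[R]_d.+1) i 0.
  by apply: cvg_mulmx => i' j'; rewrite mxE; under eq_fun => n do rewrite mxE; exact: VW.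
have finitely_many : \forall n \near \oo, forall c : 'cV['I_(q.*2.+1)]_d.+1,
    grid_point c != 0 ->
    let v : 'cV[R]_d.+1 := (V n)^T *m map_mx intr (grid_point c) in
    height (initv v) <= H -> 1 / Phi <= height (initv v) * `|lastv v|.
  apply: filter_forall => c; have [c0|c0] := eqVneq (grid_point c) 0.
    by apply: nearW => n.
  set y := grid_point c in c0 *.
  have hcvg : height (initv ((V n)^T *m map_mx intr y)) @[n --> \oo] -->
      height (initv (W^T *m map_mx intr y) : 'cV[R]_d).
    by apply: cvg_height => i; rewrite mxE; under eq_fun => n do rewrite mxE; exact: vcvg.
  have [hle|hgt] := leP (height (initv (W^T *m map_mx intr y) : 'cV[R]_d)) H.
    have pcvg : height (initv ((V n)^T *m map_mx intr y)) *
        `|lastv ((V n)^T *m map_mx intr y)| @[n --> \oo] -->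
        height (initv (W^T *m map_mx intr y)) * `|lastv (W^T *m map_mx intr y)|.
      by apply: cvgM hcvg _; apply: cvg_norm; exact: vcvg.
    near=> n; move=> _ /= _; apply: ltW; near: n.
    by apply: cvgr_gt pcvg _ _; exact: dioph.
  near=> n; move=> _ /= le; exfalso; move: le; apply/negP; rewrite -ltNge.
  by near: n; apply: cvgr_gt hcvg _ _.
near=> n; move=> m m0 /=; set v := (V n)^T *m map_mx intr m => vH.
have [last1|last1] := leP 1 `|lastv v|.
  apply: (@le_trans _ _ 1); first by rewrite ler_pdivrMr // mul1r.
  exact: mulr_ege1 (height_ge1 _) last1.
have Vn : V n \in unitmx by near: n.
have Van : forall i j, `|invmx (V n) i j| <= a by near: n.
have vle : forall i, `|v i 0| <= H.
  apply: widen_or_max => [i|]; last by rewrite (le_trans (ltW last1)).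
  by rewrite -initv_widen (le_trans (coord_le_height _ _)).
have [c mE] : exists c, m = grid_point (q := q) c.
  apply: grid_pointP => i; rewrite -(ler_int R) intr_norm.
  have -> : (m i 0)%:~R = ((invmx (V n))^T *m v) i 0 :> R.
    by rewrite /v mulmxA -trmx_mul mulmxV // trmx1 mul1mx mxE.
  apply: (@le_trans _ _ (d.+1%:R * (a * H))).
    by apply: norm_mulmx_le => // i' j'; rewrite mxE.
  exact/ltW/truncnS_gt.
have fm : forall c : 'cV['I_(q.*2.+1)]_d.+1, grid_point c != 0 ->
    let v : 'cV[R]_d.+1 := (V n)^T *m map_mx intr (grid_point c) in
    height (initv v) <= H -> 1 / Phi <= height (initv v) * `|lastv v|.
  by near: n; exact: finitely_many.
by move: vH m0; rewrite /v mE => vH m0; exact: fm.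
Unshelve. all: by end_near. Qed.

(** * Smooth counting in a unimodular lattice *)

Lemma compact_bump_le (R : realType) (K K' : R) (f : R -> R) :
  K <= K' -> compact_bump K f -> compact_bump K' f.
Proof.
move=> KK [cf fK f0 f1 f2]; split=> // [x|x u u01|x u u01].
- exact: le_trans (fK x) KK.
- by apply: le_trans (f1 _ _ u01) _; apply: ler_wpM2r => //; case/andP: u01.
- by apply: le_trans (f2 _ _ u01) _; apply: ler_wpM2r => //; exact: sqr_ge0.
Qed.

Lemma entries_bounded (R : realType) k (V : nat -> 'M[R]_k) (W : 'M[R]_k) :
  (forall i j, V n i j @[n --> \oo] --> W i j) ->
  exists b : R, \forall n \near \oo, forall i j, `|V n i j| <= b.
Proof.
move=> VW; exists (1 + \sum_(p : 'I_k * 'I_k) `|W p.1 p.2|).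
have : \forall n \near \oo, forall p : 'I_k * 'I_k, `|V n p.1 p.2| <= 1 + `|W p.1 p.2|.
  apply: filter_forall => p; near=> n; apply: ltW; near: n.
  by apply: cvgr_lt (cvg_norm (VW p.1 p.2)) _ _; rewrite ltrDr.
apply: filterS => n bnd i j; apply: le_trans (bnd (i, j)) _.
by rewrite lerD2l (bigD1 (i, j)) //= lerDl sumr_ge0.
Unshelve. all: by end_near. Qed.

(** Limit of [rational_lattice_bound] along roundings of T * A^-1. The
    weights vanish outside a fixed ball, so a fixed grid [-q, q]^k contains all
    the points that count, both for A and for its approximations; finite sums
    and products pass to the limit, and |det V| tends to 1. *)
Lemma smooth_lattice_count (R : realType) d (A : 'M[R]_d.+1)
    (w : 'I_d.+1 -> R -> R) (K H Phi : R) (g r : 'I_d.+1 -> R) :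
  let f i x := w i ((x - g i) / r i) in
  unimodular_basis A ->
  0 <= K -> (forall i, compact_bump K (w i)) -> (forall i, 0 < r i) ->
  1 <= H -> 1 <= Phi -> H * Phi = r ord_max ->
  (forall i, r (widen_ord (leqnSn d) i) <= 1) ->
  (forall m : 'cV[int]_d.+1, m != 0 ->
     let v : 'cV[R]_d.+1 := (invmx A)^T *m map_mx intr m in
     height (initv v) <= H -> 1 / Phi < height (initv v) * `|lastv v|) ->
  exists q, (forall y : 'cV[int]_d.+1,
      \prod_i f i ((A *m map_mx intr y) i 0) != 0 ->
      exists c, y = grid_point (q := q) c) /\
    `|\sum_(c : 'cV['I_(q.*2.+1)]_d.+1)
        \prod_i f i ((A *m map_mx intr (grid_point c)) i 0)
      - \prod_i (r i * \int[lebesgue_measure]_t w i t)|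
    <= (8 * K) ^+ d.+1 * (2 * 32 ^+ d.+1 * Phi).
Proof.
move=> f [Au detA] K0 wP r0 H1 Phi1 HPhi r1 dioph.
have Phi0 : 0 < Phi by exact: lt_le_trans Phi1.
pose B n := rational_approx (invmx A) n.+1.
pose V n : 'M[R]_d.+1 := int_quotient R (B n) n.+1.
have VA i j : V n i j @[n --> \oo] --> invmx A i j by exact: cvg_rational_approx.
have invAu : invmx A \in unitmx by rewrite unitmx_inv.
have [Vu QA] := cvg_invmx invAu VA; rewrite invmxK in QA.
have [b Vb] := entries_bounded VA; have [a Va] := entries_bounded QA.
pose G := \sum_i (`|g i| + 2 * r i).
have gG i : `|g i| + 2 * r i <= G.
  rewrite /G (bigD1 i) //= lerDl sumr_ge0 // => j _.
  by rewrite addr_ge0 // mulr_ge0 // ltW.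
have fG i x : G < `|x| -> f i x = 0.
  move=> Gx; have [_ _ w0 _ _] := wP i; rewrite /f w0 //.
  rewrite normrM normfV (gtr0_norm (r0 i)) ltr_pdivlMr //.
  have := gG i; have := ler_normD (x - g i) (g i); rewrite subrK; lra.
pose q := (Num.truncn (d.+1%:R * (b * G))).+1.
have qG : d.+1%:R * (b * G) <= q%:R by exact/ltW/truncnS_gt.
exists q; split.
  move=> y fy; apply: grid_pointP => i; rewrite -(ler_int R) intr_norm.
  have yE : (y i 0)%:~R = (invmx A *m (A *m map_mx intr y)) i 0 :> R.
    by rewrite mulmxA mulVmx // mul1mx mxE.
  rewrite yE; apply: le_trans qG; apply: norm_mulmx_le => [i' j|j].
    have Vb' : \forall n \near \oo, `|V n i' j| <= b.
      by apply: filterS Vb => n; apply.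
    exact: (ler_cvg_to (cvg_norm (VA i' j)) (cvg_cst b) Vb').
  rewrite leNgt; apply: contra fy => Gj; rewrite (bigD1 j) //=.
  by rewrite fG // mul0r.
set S := \sum_c _; set main := \prod_i _; set C := _ * (_ * Phi).
pose Sn n := \sum_(c : 'cV['I_(q.*2.+1)]_d.+1)
  \prod_i f i ((invmx (V n) *m map_mx intr (grid_point c)) i 0).
pose good n (mu : 'I_d.+1 -> R) :=
  (forall i, `|mu i - r i * \int[lebesgue_measure]_t w i t| <= K / r i / n.+1%:R) /\
  `|Sn n - `|\det (V n)| * \prod_i mu i| <= `|\det (V n)| * C.
have near_good : \forall n \near \oo, exists mu, good n mu.
  have near_dioph := near_diophantine H1 Phi1 VA Vu Va dioph.
  have rT : \forall n \near \oo, forall i, n.+1%:R^-1 <= r i.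
    apply: filter_forall => i; near=> n.
    rewrite invf_ple ?posrE //; apply: ltW; near: n; exact: near_large.
  near=> n.
  have Vn : V n \in unitmx by near: n.
  have Vbn : forall i j, `|V n i j| <= b by near: n.
  have Van : forall i j, `|invmx (V n) i j| <= a by near: n.
  have rTn : forall i, 0 < r i /\ n.+1%:R^-1 <= r i.
    have rTn' : forall i, n.+1%:R^-1 <= r i by near: n.
    by move=> i.
  have GTn : 2 * (G + 2) < n.+1%:R by near: n; exact: near_large.
  have aqn : 2 * (d.+1%:R * (a * q%:R)) < n.+1%:R by near: n; exact: near_large.
  have dion : forall m : 'cV[int]_d.+1, m != 0 ->
      let v : 'cV[R]_d.+1 := (V n)^T *m map_mx intr m in
      height (initv v) <= H -> 1 / Phi <= height (initv v) * `|lastv v|.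
    by near: n.
  have [mu mu1 mu2] := @rational_lattice_bound R d (B n) n.+1 q w K G H Phi a b g r
    Vn Vbn Van K0 wP rTn gG GTn qG aqn H1 Phi0 HPhi r1 dion.
  by exists mu.
(* The masses mu exist only for large n; any value will do before. *)
have total n : exists mu, (exists mu', good n mu') -> good n mu.
  have [[mu goodmu]|none] := pselect (exists mu', good n mu'); first by exists mu.
  by exists (fun=> 0).
have [mu muP] := choice total.
have near_mu : \forall n \near \oo, good n (mu n).
  by apply: filterS near_good => n; exact: muP.
have detV : `|\det (V n)| @[n --> \oo] --> (1 : R).
  have <- : `|\det (invmx A)| = 1 by rewrite det_inv normfV detA invr1.
  by apply: cvg_norm; exact: cvg_det.
have Scvg : Sn n @[n --> \oo] --> S.
  apply: cvg_sumr => c; apply: cvg_prodr => i.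
  have [cw _ _ _ _] := wP i.
  have arg : (((invmx (V n) *m map_mx intr (grid_point c)) i 0 - g i) / r i)
      @[n --> \oo] --> ((A *m map_mx intr (grid_point c)) i 0 - g i) / r i.
    apply: cvgM; last exact: cvg_cst.
    by apply: cvgB; [apply: cvg_mulmx | exact: cvg_cst].
  by apply: (continuous_cvg _ _ arg); exact: cw.
have mucvg i : mu n i @[n --> \oo] --> r i * \int[lebesgue_measure]_t w i t.
  set l := r i * _; have e0 := cvg_harmonic_cst (K / r i).
  have lo : l - K / r i / n.+1%:R @[n --> \oo] --> l.
    by rewrite -[X in _ --> X]subr0; apply: cvgB; [exact: cvg_cst|].
  have hi : l + K / r i / n.+1%:R @[n --> \oo] --> l.
    by rewrite -[X in _ --> X]addr0; apply: cvgD; [exact: cvg_cst|].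
  apply: (squeeze_cvgr _ lo hi); apply: filterS near_mu => n [/(_ i) mui _].
  by rewrite -ler_distl.
have lhs : `|Sn n - `|\det (V n)| * \prod_i mu n i| @[n --> \oo] --> `|S - main|.
  apply: cvg_norm; apply: cvgB => //; rewrite -[main]mul1r.
  by apply: cvgM => //; exact: cvg_prodr.
have rhs : `|\det (V n)| * C @[n --> \oo] --> C.
  by rewrite -[X in _ --> X]mul1r; apply: cvgM => //; exact: cvg_cst.
apply: (ler_cvg_to lhs rhs); apply: filterS near_mu => n [_ bound].
exact: bound.
Unshelve. all: by end_near. Qed.

(** * The discrepancy *)

Lemma esum_lattice (R : realType) k q (A : 'M[R]_k) (F : 'cV[R]_k -> R) :
  A \in unitmx -> (forall v, 0 <= F v) ->
  (forall y : 'cV[int]_k, F (A *m map_mx intr y) != 0 ->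
     exists c, y = grid_point (q := q) c) ->
  \esum_(v in lattice A) (F v)%:E =
  (\sum_(c : 'cV['I_(q.*2.+1)]_k) F (A *m map_mx intr (grid_point c)))%:E.
Proof.
move=> Au F0 supp_grid; pose v c := A *m map_mx intr (grid_point (q := q) c).
have vinj : injective v.
  move=> c c' /(congr1 (mulmx (invmx A))); rewrite !mulmxA !mulVmx // !mul1mx.
  move=> /colP cc; apply: (@grid_point_inj k q); apply/colP => i.
  by have := cc i; rewrite !mxE => /intr_inj.
have -> : \esum_(v in lattice A) (F v)%:E =
    \esum_(x in v @` [set: 'cV['I_(q.*2.+1)]_k]) (F x)%:E.
  rewrite esum_mkcond [RHS]esum_mkcond; apply: eq_esum => x _.
  case: ifPn => [|xL]; rewrite ?inE.
    case=> y _ yx; case: ifPn => // /negP xD; congr (_%:E); apply/eqP/negPn/negP => Fx.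
    have [c yE] : exists c, y = grid_point (q := q) c by apply: supp_grid; rewrite yx.
    by apply: xD; rewrite inE; exists c => //; rewrite /v -yE.
  case: ifPn => //; rewrite inE => -[c _ cx]; move/negP: xL; case.
  by rewrite inE; exists (grid_point c).
rewrite esum_image; last by move=> c c' _ _; exact: vinj.
have -> : [set: 'cV['I_(q.*2.+1)]_k] = [set` index_enum 'cV['I_(q.*2.+1)]_k].
  by apply/seteqP; split=> c //= _; rewrite mem_index_enum.
rewrite esum_fset; [|exact: finite_seq|by move=> c _; rewrite lee_fin].
by rewrite -sumEFin -fsbig_seq // index_enum_uniq.
Qed.

Lemma fourier_at0 (R : realType) (f : R -> R) :
  fourier f 0 = ((\int[lebesgue_measure]_x f x)%:C)%C.
Proof.
rewrite /fourier /cintegral.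
have e0 x : (f x)%:C%C * expi (- 0 * x) = (f x)%:C%C.
  by rewrite oppr0 mul0r expi0 mulr1.
under [X in (X +i* _)%C]eq_Rintegral => x _ do rewrite e0 /=.
under [X in (_ +i* X)%C]eq_Rintegral => x _ do rewrite e0 /=.
by rewrite Rintegral_cst // mul0r.
Qed.

Lemma frakC_integral (R : realType) k (w : 'I_k -> R -> R) :
  frakC w = \prod_i \int[lebesgue_measure]_x w i x.
Proof.
rewrite /frakC (eq_bigr _ (fun i _ => fourier_at0 (w i))).
by rewrite -rmorph_prod.
Qed.

Lemma limf_esup_ratio_ge1 (R : realType) (phi : R -> R) (xi : R) :
  (forall x, 1 <= x -> 1 <= phi x) ->
  (forall x y, 1 <= x -> x <= y -> phi x <= phi y) ->
  limf_esup (fun x : R => (phi (2 * x) / phi x)%:E) +oo%R = xi%:E -> 1 <= xi.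
Proof.
move=> phi1 phi_ndecr xiE; rewrite -lee_fin -xiE limf_esupE.
apply: le_ereal_inf_tmp => _ [V [M [_ MV]] <-].
pose x := Num.max (M + 1) 1; have x1 : 1 <= x by rewrite le_max lexx orbT.
apply: (@le_trans _ _ (phi (2 * x) / phi x)%:E).
  rewrite lee_fin ler_pdivlMr ?(lt_le_trans ltr01 (phi1 _ x1)) // mul1r.
  by apply: phi_ndecr => //; lra.
apply: ereal_sup_ubound; exists x => //; apply: MV.
by rewrite /x lt_max ltrDl ltr01.
Qed.

Lemma box_discrepancyE (R : realType) d (omega : 'I_d.+1 -> R -> R)
    (A : 'M[R]_d.+1) (gamma rho : 'cV[R]_d) (N : nat) :
  let g := snoc (fun i => gamma i 0) 0 in
  let r := snoc (fun i => rho i 0) N%:R in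
  box_discrepancy omega (lattice A) gamma rho N =
  (\esum_(v in lattice A) (\prod_i omega i ((v i 0 - g i) / r i))%:E
    - (\prod_i (r i * \int[lebesgue_measure]_t omega i t))%:E)%E.
Proof.
move=> g r; rewrite /box_discrepancy; congr (_ - _%:E)%E.
  apply: eq_esum => v _; congr (_%:E); rewrite big_ord_recr /= mulrC.
  rewrite /g /r !snoc_max subr0; congr (_ * _).
  by apply: eq_bigr => i _; rewrite !snoc_widen initv_widen.
rewrite big_split /= frakC_integral mulrC; congr (_ * _).
rewrite /box_vol big_ord_recr /= /r snoc_max; congr (_ * _).
by apply: eq_bigr => i _; rewrite snoc_widen.
Qed.

Theorem theorem1p13 (R : realType) (d l : nat) (hd : (0 < d)%N)
    (omega : 'I_d.+1 -> R -> R) (homega : classG l omega)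
    (A : 'M[R]_d.+1) (hA : unimodular_basis A)
    (phi L : R -> R)
    (phi_ge1 : forall x, 1 <= x -> 1 <= phi x)
    (phi_ndecr : forall x y, 1 <= x -> x <= y -> phi x <= phi y)
    (hL : forall x, phi 1 <= x -> (1 <= L x <= x) /\ L x * phi (L x) = x)
    (hdual : forall v : 'cV[R]_d.+1, dual_lattice A v -> v != 0 ->
       `|height (initv v) * lastv v| > 1 / phi (height (initv v)))
    (xi : R)
    (hxi : limf_esup (fun x : R => (phi (2 * x) / phi x)%:E) +oo%R = xi%:E)
    (hl : l%:R > 2 + 2 * (ln xi / ln 2)) :
  exists C : R, forall N : nat, (0 < N)%N -> phi 1 <= N%:R ->
    (discrepancy omega (lattice A) N <= (C * phi (L N%:R))%:E)%E.
Proof.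
have xi1 := limf_esup_ratio_ge1 phi_ge1 phi_ndecr hxi.
have l2 : (2 <= l)%N.
  rewrite -(ler_nat R); apply: ltW; apply: le_lt_trans hl.
  by rewrite lerDl mulr_ge0 // divr_ge0 ?ln_ge0 // ler1n.
have bump i : exists2 K : R, 0 <= K & compact_bump K (omega i).
  by have [_ smooth suppi _ _] := homega i; exact: smooth_compact_bump l2 smooth suppi.
have [Kf KfP] := choice (fun i => let: ex_intro2 K K0 KP := bump i in
  ex_intro (fun K => 0 <= K /\ compact_bump K (omega i)) K (conj K0 KP)).
pose K := \sum_i Kf i.
have K0 : 0 <= K by apply: sumr_ge0 => i _; have [] := KfP i.
have wP i : compact_bump K (omega i).
  have [_] := KfP i; apply: compact_bump_le; rewrite /K (bigD1 i) //= lerDl.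
  by apply: sumr_ge0 => j _; have [] := KfP j.
have Au : A \in unitmx by have [] := hA.
exists ((8 * K) ^+ d.+1 * (2 * 32 ^+ d.+1)) => N N0 phiN.
have [/andP[H1 _] HPhi] := hL _ phiN.
set H := L N%:R in H1 HPhi *.
apply: ge_ereal_sup => _ [gamma [rho [rhoP ->]]].
rewrite box_discrepancyE.
set g := snoc _ 0; set r := snoc _ N%:R.
have r0 i : 0 < r i.
  move: i; apply: widen_or_max => [i|]; rewrite /r ?snoc_widen ?snoc_max ?ltr0n //.
  by have /andP[] := rhoP i.
have rmax : H * phi H = r ord_max by rewrite /r snoc_max.
have r1 i : r (widen_ord (leqnSn d) i) <= 1.
  by rewrite /r snoc_widen; have /andP[_] := rhoP i; lra.
have dioph (m : 'cV[int]_d.+1) : m != 0 ->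
    let v : 'cV[R]_d.+1 := (invmx A)^T *m map_mx intr m in
    height (initv v) <= H -> 1 / phi H < height (initv v) * `|lastv v|.
  move=> m0 /=; set v := _ *m _ => vH.
  have v0 : v != 0.
    apply: contraNneq m0 => v0; apply/eqP/colP => i; apply: (@intr_inj R).
    have : A^T *m v = 0 by rewrite v0 mulmx0.
    by rewrite /v mulmxA -trmx_mul mulVmx // trmx1 mul1mx => /colP/(_ i); rewrite !mxE.
  have /hdual /(_ v0) : dual_lattice A v by exists m.
  rewrite normrM (ger0_norm (height_ge0 _)); apply: le_lt_trans.
  have h1 := height_ge1 (initv v).
  rewrite !div1r lef_pV2 ?posrE ?(lt_le_trans ltr01 (phi_ge1 _ _)) //.
  exact: phi_ndecr.
have [q [supp_grid bound]] := @smooth_lattice_count R d A omega K H (phi H) g r hA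
  K0 wP r0 H1 (phi_ge1 _ H1) rmax r1 dioph.
rewrite (@esum_lattice R _ q A (fun v => \prod_i omega i ((v i 0 - g i) / r i))) //.
- by rewrite -EFinB -mulrA lee_fin.
- by move=> v; apply: prodr_ge0 => i _; have [] := homega i.
Qed.
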